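(* Free $C^\infty$-rings are commutative Rota-Baxter algebras over $\mathbb{R}$: for every real vector space $V$ and every $\vec v\in V$, with corresponding linear map $v:\mathbb{R}\to V$, $1\mapsto\vec v$, the free $C^\infty$-ring $S^\infty(V)$, with its underlying commutative $\mathbb{R}$-algebra structure, together with the linear operator $$\mathsf{P}_v:\ S^\infty(V)\xrightarrow{\ 1\otimes v\ }S^\infty(V)\otimes V\xrightarrow{\ \mathsf{s}_V\ }S^\infty(V)$$ is a commutative Rota-Baxter algebra (of weight $0$) over $\mathbb{R}$.
   Context: Conventions: composition in diagrammatic order ($fg$ means first $f$, then $g$); associators and unitors suppressed (so $S^\infty(V)\cong S^\infty(V)\otimes\mathbb{R}$ in the definition of $\mathsf{P}_v$). A (commutative) Rota-Baxter algebra (of weight $0$) over a commutative ring $R$ is a pair $(A,\mathsf{P})$ with $A$ a (commutative) $R$-algebra and $\mathsf{P}:A\to A$ an $R$-linear map with $\mathsf{P}(a)\mathsf{P}(b)=\mathsf{P}(a\mathsf{P}(b))+\mathsf{P}(\mathsf{P}(a)b)$ for all $a,b\in A$. $C^\infty$-rings: a $C^\infty$-ring $(X,\Phi)$ is a set $X$ with an operation $\Phi_f:X^m\to X$ for each smooth $f:\mathbb{R}^m\to\mathbb{R}$, $m\in\mathbb{N}$, such that $\Phi_{\pi_i}$ is the $i$-th projection and $\Phi_{g\circ\langle f_1,\dots,f_m\rangle}=\Phi_g\circ\langle\Phi_{f_1},\dots,\Phi_{f_m}\rangle$; morphisms preserve all operations. Each has an underlying commutative $\mathbb{R}$-algebra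 (from the polynomial operations). The forgetful functor from $C^\infty$-rings to the category $\mathbb{R}\text{-}\mathrm{Vec}$ of real vector spaces has a left adjoint; $(S^\infty,\mu,\eta)$ is the induced (finitary) monad, so $S^\infty(V)$ is the free $C^\infty$-ring on $V$, and $\mathsf{m}_V,\mathsf{u}_V$ are the multiplication and unit of its underlying $\mathbb{R}$-algebra. One has $S^\infty(\mathbb{R}^n)=C^\infty(\mathbb{R}^n)$ with operations $\Phi_g(f_1,\dots,f_m)=g\circ\langle f_1,\dots,f_m\rangle$, $\eta_{\mathbb{R}^n}(e_i)=\pi_i$, and $S^\infty(h)(g)=g\circ h^*$ for linear $h$ with transpose $h^*$. $\mathsf{d}:S^\infty(-)\Rightarrow S^\infty(-)\otimes(-)$ is the unique natural transformation with $\mathsf{d}_{\mathbb{R}^n}(f)=\sum_{i=1}^n\frac{\partial f}{\partial x_i}\otimes e_i$ for all $n$ and $f\in C^\infty(\mathbb{R}^n)$ (natural transformations between finitary endofunctors of $\mathbb{R}\text{-}\mathrm{Vec}$ are determined by, and extend uniquely from, their restrictions to the full subcategory on the spaces $\mathbb{R}^n$). Put $\mathsf{d}^\circ_V=(1\otimes\eta_V)\mathsf{m}_V:S^\infty(V)\otimes V\to S^\infty(V)$ and $\mathsf{K}=\mathsf{d}\mathsf{d}^\circ+S^\infty(0):S^\infty\Rightarrow S^\infty$. The transformation $\mathsf{K}$ is a natural isomorphism, and $\mathsf{s}:=\mathsf{d}^\circ\mathsf{K}^{-1}$ is a natural transformation with components $\mathsf{s}_V:S^\infty(V)\otimes V\to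 S^\infty(V)$; on $\mathbb{R}^n$ it is given by $\mathsf{s}_{\mathbb{R}^n}(\sum_if_i\otimes e_i)(\vec w)=\int_0^1\sum_if_i(t\vec w)w_i\,\mathsf{d}t$. *)

(* Defs.v *)
From HB Require Import structures.
From mathcomp Require Import all_boot all_order all_algebra.
From mathcomp Require Import all_classical all_reals all_analysis.

Set Implicit Arguments.
Unset Strict Implicit.
Unset Printing Implicit Defensive.

Import Order.TTheory GRing.Theory Num.Theory.
Import numFieldNormedType.Exports.

Local Open Scope classical_set_scope.
Local Open Scope ring_scope.

Section SmoothFunctions.
Variable R : realType.

(* k-fold Frechet differentiability *)
Fixpoint ndiff (k n : nat) (f : 'rV[R]_n -> R) : Prop :=
  if k is k'.+1 then
    (forall x, differentiable f x) /\
    (forall i, ndiff k' (fun x => 'D_(delta_mx 0 i) f x))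
  else True.

Definition smooth n (f : 'rV[R]_n -> R) : Prop := forall k, ndiff k f.

Lemma ndiffW k n (f : 'rV[R]_n -> R) : ndiff k.+1 f -> ndiff k f.
Proof.
by elim: k f => [//|k IH] f [df Df]; split=> // i; apply: IH; exact: Df.
Qed.

Lemma ndiff_cst k n (c : R) : ndiff k (fun _ : 'rV[R]_n => c).
Proof.
elim: k c => [//|k IH] c; split=> [x|i]; first exact: differentiable_cst.
have -> : (fun x : 'rV[R]_n => 'D_(delta_mx 0 i) (fun=> c) x) = (fun=> 0).
  by apply/funext => x; exact: derive_cst.
exact: IH.
Qed.

Lemma ndiffD k n (f g : 'rV[R]_n -> R) :
  ndiff k f -> ndiff k g -> ndiff k (fun x => f x + g x).
Proof.
elim: k f g => [//|k IH] f g [df Df] [dg Dg]; split=> [x|i].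
  exact: differentiableD.
have -> : (fun x => 'D_(delta_mx 0 i) (fun x => f x + g x) x) =
  (fun x => 'D_(delta_mx 0 i) f x + 'D_(delta_mx 0 i) g x).
  by apply/funext => x; apply: deriveD; exact: diff_derivable.
by apply: IH; [exact: Df|exact: Dg].
Qed.

Lemma partialM n (f g : 'rV[R]_n -> R) i x :
  differentiable f x -> differentiable g x ->
  'D_(delta_mx 0 i) (fun x => f x * g x) x =
  f x * 'D_(delta_mx 0 i) g x + g x * 'D_(delta_mx 0 i) f x.
Proof. by move=> df dg; rewrite deriveM //; exact: diff_derivable. Qed.

Lemma ndiffM k n (f g : 'rV[R]_n -> R) :
  ndiff k f -> ndiff k g -> ndiff k (fun x => f x * g x).
Proof.
elim: k f g => [//|k IH] f g /[dup] /ndiffW wf [df Df] /[dup] /ndiffW wg [dg Dg].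
split=> [x|i]; first exact: differentiableM.
under eq_fun do rewrite partialM //.
by apply: ndiffD; apply: IH => //; [exact: Dg|exact: Df].
Qed.

Lemma ndiff_sum k n m (f : 'I_m -> 'rV[R]_n -> R) :
  (forall j, ndiff k (f j)) -> ndiff k (fun x => \sum_j f j x).
Proof.
elim: m f => [|m IH] f df.
  under eq_fun do rewrite big_ord0.
  exact: ndiff_cst.
under eq_fun do rewrite big_ord_recl.
by apply: ndiffD => //; apply: IH.
Qed.

Lemma row_sumE n m (f : 'I_m -> 'rV[R]_n -> R) :
  (fun x => \row_j f j x) = \sum_j (fun x => f j x *: delta_mx 0 j : 'rV[R]_m).
Proof.
apply/funext => x; rewrite fct_sumE (row_sum_delta (\row_j f j x)).
by apply: eq_bigr => j _; rewrite mxE.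
Qed.

Lemma differentiable_row n m (f : 'I_m -> 'rV[R]_n -> R) x :
  (forall j, differentiable (f j) x) ->
  differentiable (fun x => \row_j f j x : 'rV[R]_m) x.
Proof.
move=> df; rewrite row_sumE; apply: differentiable_sum => j.
exact: differentiableZl.
Qed.

Lemma derive_row n m (f : 'I_m -> 'rV[R]_n -> R) x v :
  (forall j, differentiable (f j) x) ->
  'D_v (fun x => \row_j f j x : 'rV[R]_m) x = \row_j 'D_v (f j) x.
Proof.
move=> df; rewrite row_sumE derive_sum; last first.
  by move=> j; apply: diff_derivable; exact: differentiableZl.
rewrite [RHS]row_sum_delta; apply: eq_bigr => j _.
rewrite deriveE; last exact: differentiableZl.
by rewrite diffZl // mxE deriveE.
Qed.

Lemma partial_comp n m (g : 'rV[R]_m -> R) (f : 'I_m -> 'rV[R]_n -> R) i x :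
  (forall y, differentiable g y) -> (forall j, differentiable (f j) x) ->
  'D_(delta_mx 0 i) (fun x => g (\row_j f j x)) x =
  \sum_j 'D_(delta_mx 0 j) g (\row_j f j x) * 'D_(delta_mx 0 i) (f j) x.
Proof.
move=> dg df; pose F x := \row_j f j x : 'rV[R]_m.
have dF : differentiable F x by exact: differentiable_row.
rewrite -[fun x => g _]/(g \o F) deriveE; last exact: differentiable_comp.
rewrite diff_comp //= -(deriveE _ dF) derive_row //.
rewrite [X in 'd g _ X]row_sum_delta linear_sum; apply: eq_bigr => j _.
by rewrite linearZ /= mxE [X in _ = X * _]deriveE // mulrC.
Qed.

Lemma ndiff_comp k n m (g : 'rV[R]_m -> R) (f : 'I_m -> 'rV[R]_n -> R) :
  ndiff k g -> (forall j, ndiff k (f j)) ->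
  ndiff k (fun x => g (\row_j f j x)).
Proof.
elim: k g f => [//|k IH] g f [dg Dg] df.
have df1 j x : differentiable (f j) x by have [] := df j.
split=> [x|i].
  apply: (@differentiable_comp _ _ _ _ (fun x => \row_j f j x) g) => //.
  exact: differentiable_row.
under eq_fun do rewrite partial_comp //.
apply: ndiff_sum => j; apply: ndiffM; last exact: (df j).2.
by apply: (IH (fun y => 'D_(delta_mx 0 j) g y)) => [|j']; [exact: Dg|exact: ndiffW].
Qed.

Lemma ndiff_coord k n (i : 'I_n) : ndiff k (fun x : 'rV[R]_n => x 0 i).
Proof.
case: k => [//|k]; split=> [x|j]; first exact: differentiable_coord.
have -> : (fun x : 'rV[R]_n => 'D_(delta_mx 0 j) (fun x : 'rV[R]_n => x 0 i) x) =
  (fun=> (i == j)%:R).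
  apply/funext => x; rewrite deriveE; last exact: differentiable_coord.
  have @f : {linear 'rV[R]_n -> R}.
    by exists (fun N : 'rV[R]_n => N 0 i); do 2![eexists]; do ?[constructor];
     rewrite ?mxE// => ? *; rewrite ?mxE//; move=> ?; rewrite !mxE.
  rewrite (_ : (fun _ => _) = f) // diff_lin /= ?mxE ?eqxx //.
  exact: coord_continuous.
exact: ndiff_cst.
Qed.

Record sfun (n : nat) := SFun {
  sfun_val :> 'rV[R]_n -> R;
  sfun_smooth : smooth sfun_val }.

Lemma sfunP n (f g : sfun n) : (forall x, f x = g x) -> f = g.
Proof.
case: f g => f sf [g sg] /= /funext fg; move: sf sg.
by rewrite fg => sf sg; congr SFun; exact: Prop_irrelevance.
Qed.

Definition sproj n (i : 'I_n) : sfun n :=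
  SFun (fun k => ndiff_coord k i).

Definition scomp m n (g : sfun m) (f : 'I_m -> sfun n) : sfun n :=
  SFun (fun k => ndiff_comp (sfun_smooth g k) (fun j => sfun_smooth (f j) k)).

Definition spartial n (i : 'I_n) (f : sfun n) : sfun n :=
  SFun (fun k => (sfun_smooth f k.+1).2 i).

Definition scst n (c : R) : sfun n := SFun (fun k => @ndiff_cst k n c).

Definition sadd n (f g : sfun n) : sfun n :=
  SFun (fun k => ndiffD (sfun_smooth f k) (sfun_smooth g k)).

Definition smul n (f g : sfun n) : sfun n :=
  SFun (fun k => ndiffM (sfun_smooth f k) (sfun_smooth g k)).

Definition ssum n m (f : 'I_m -> sfun n) : sfun n :=
  SFun (fun k => ndiff_sum (fun j => sfun_smooth (f j) k)).

Lemma sfun_differentiable n (f : sfun n) x : differentiable f x.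
Proof. by have [] := sfun_smooth f 1. Qed.

Lemma spartial_proj n (i j : 'I_n) :
  spartial i (sproj j) = scst n (j == i)%:R.
Proof.
apply: sfunP => x /=; rewrite deriveE; last exact: differentiable_coord.
have @f : {linear 'rV[R]_n -> R}.
  by exists (fun N : 'rV[R]_n => N 0 j); do 2![eexists]; do ?[constructor];
   rewrite ?mxE// => ? *; rewrite ?mxE//; move=> ?; rewrite !mxE.
rewrite (_ : (fun _ => _) = f) // diff_lin /= ?mxE ?eqxx //.
exact: coord_continuous.
Qed.

Lemma spartial_comp m n (g : sfun m) (f : 'I_m -> sfun n) i :
  spartial i (scomp g f) =
  ssum (fun j => smul (scomp (spartial j g) f) (spartial i (f j))).
Proof.
apply: sfunP => x /=; rewrite partial_comp //; first exact: sfun_differentiable.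
by move=> j; exact: sfun_differentiable.
Qed.

Lemma spartial_cst n c i : spartial i (scst n c) = scst n 0.
Proof. by apply: sfunP => x /=; exact: derive_cst. Qed.

Lemma spartialD n (f g : sfun n) i :
  spartial i (sadd f g) = sadd (spartial i f) (spartial i g).
Proof.
apply: sfunP => x /=.
by apply: deriveD; apply: diff_derivable; exact: sfun_differentiable.
Qed.

Lemma spartialM n (f g : sfun n) i :
  spartial i (smul f g) = sadd (smul f (spartial i g)) (smul g (spartial i f)).
Proof. by apply: sfunP => x /=; apply: partialM; exact: sfun_differentiable. Qed.

End SmoothFunctions.

Record cinfRing (R : realType) := CinfRing {
  cr_sort :> Type;
  cr_op : forall n, sfun R n -> ('I_n -> cr_sort) -> cr_sort;
  cr_proj : forall n (i : 'I_n) (a : 'I_n -> cr_sort),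
    cr_op (sproj R i) a = a i;
  cr_comp : forall m n (g : sfun R m) (f : 'I_m -> sfun R n)
      (a : 'I_n -> cr_sort),
    cr_op (scomp g f) a = cr_op g (fun j => cr_op (f j) a) }.

Definition cinf_hom (R : realType) (X Y : cinfRing R) (h : X -> Y) : Prop :=
  forall n (f : sfun R n) (a : 'I_n -> X), h (cr_op f a) = cr_op f (h \o a).

Section UnderlyingAlgebra.
Variable R : realType.

Definition pair2 T (x y : T) : 'I_2 -> T := fun i => if i == ord0 then x else y.

Definition triple3 T (x y z : T) : 'I_3 -> T :=
  fun i => if i == 0%R then x else if i == 1%R then y else z.

Definition sadd2 : sfun R 2 := sadd (sproj R 0) (sproj R 1).
Definition smul2 : sfun R 2 := smul (sproj R 0) (sproj R 1).
Definition sscale1 (c : R) : sfun R 1 := smul (scst 1 c) (sproj R 0).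

Variable X : cinfRing R.
Implicit Types x y z : X.

Definition cr_cst (c : R) : X :=
  cr_op (scst 0 c) (fun i => match notF (ltn_ord i) with end).
Definition cr_add x y : X := cr_op sadd2 (pair2 x y).
Definition cr_mul x y : X := cr_op smul2 (pair2 x y).
Definition cr_scale (c : R) x : X := cr_op (sscale1 c) (fun=> x).

Lemma cr_addE n (f g : sfun R n) (a : 'I_n -> X) :
  cr_add (cr_op f a) (cr_op g a) = cr_op (sadd f g) a.
Proof.
have -> : sadd f g = scomp sadd2 (pair2 f g).
  by apply: sfunP => w /=; rewrite !mxE.
rewrite cr_comp; congr cr_op; apply/funext => j; rewrite /pair2.
by case: ifP.
Qed.

Lemma cr_mulE n (f g : sfun R n) (a : 'I_n -> X) :
  cr_mul (cr_op f a) (cr_op g a) = cr_op (smul f g) a.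
Proof.
have -> : smul f g = scomp smul2 (pair2 f g).
  by apply: sfunP => w /=; rewrite !mxE.
rewrite cr_comp; congr cr_op; apply/funext => j; rewrite /pair2.
by case: ifP.
Qed.

Lemma cr_scaleE n c (f : sfun R n) (a : 'I_n -> X) :
  cr_scale c (cr_op f a) = cr_op (smul (scst n c) f) a.
Proof.
have -> : smul (scst n c) f = scomp (sscale1 c) (fun=> f).
  by apply: sfunP => w /=; rewrite !mxE.
by rewrite cr_comp.
Qed.

Lemma cr_cstE n c (a : 'I_n -> X) : cr_cst c = cr_op (scst n c) a.
Proof.
have -> : scst n c = scomp (scst 0 c) (fun i => match notF (ltn_ord i) with end).
  by apply: sfunP.
by rewrite cr_comp; congr cr_op; apply/funext => -[].
Qed.

Lemma triple3_sur x y z :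
  exists a : 'I_3 -> X, [/\ x = cr_op (sproj R 0) a,
    y = cr_op (sproj R 1) a & z = cr_op (sproj R 2) a].
Proof. by exists (triple3 x y z); rewrite !cr_proj. Qed.

Lemma cr_addA : associative cr_add.
Proof.
move=> x y z; have [a [-> -> ->]] := triple3_sur x y z.
by rewrite !cr_addE; congr cr_op; apply: sfunP => w /=; rewrite addrA.
Qed.

Lemma cr_addC : commutative cr_add.
Proof.
move=> x y; have [a [-> -> _]] := triple3_sur x y y.
by rewrite !cr_addE; congr cr_op; apply: sfunP => w /=; rewrite addrC.
Qed.

Lemma cr_add0 : left_id (cr_cst 0) cr_add.
Proof.
move=> x; have [a [-> _ _]] := triple3_sur x x x.
rewrite (cr_cstE 0 a) !cr_addE.
by congr cr_op; apply: sfunP => w /=; rewrite add0r.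
Qed.

Lemma cr_addN : left_inverse (cr_cst 0) (cr_scale (-1)) cr_add.
Proof.
move=> x; have [a [-> _ _]] := triple3_sur x x x.
rewrite (cr_cstE 0 a) cr_scaleE !cr_addE.
by congr cr_op; apply: sfunP => w /=; rewrite mulN1r addNr.
Qed.

Lemma cr_mulA : associative cr_mul.
Proof.
move=> x y z; have [a [-> -> ->]] := triple3_sur x y z.
by rewrite !cr_mulE; congr cr_op; apply: sfunP => w /=; rewrite mulrA.
Qed.

Lemma cr_mulC : commutative cr_mul.
Proof.
move=> x y; have [a [-> -> _]] := triple3_sur x y y.
by rewrite !cr_mulE; congr cr_op; apply: sfunP => w /=; rewrite mulrC.
Qed.

Lemma cr_mul1 : left_id (cr_cst 1) cr_mul.
Proof.
move=> x; have [a [-> _ _]] := triple3_sur x x x.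
rewrite (cr_cstE 1 a) !cr_mulE.
by congr cr_op; apply: sfunP => w /=; rewrite mul1r.
Qed.

Lemma cr_mulDl : left_distributive cr_mul cr_add.
Proof.
move=> x y z; have [a [-> -> ->]] := triple3_sur x y z.
rewrite cr_addE !cr_mulE cr_addE; congr cr_op.
by apply: sfunP => w /=; rewrite mulrDl.
Qed.

Lemma cr_scaleA c d x : cr_scale c (cr_scale d x) = cr_scale (c * d) x.
Proof.
have [a [-> _ _]] := triple3_sur x x x.
by rewrite !cr_scaleE; congr cr_op; apply: sfunP => w /=; rewrite mulrA.
Qed.

Lemma cr_scale1 : left_id 1 cr_scale.
Proof.
move=> x; have [a [-> _ _]] := triple3_sur x x x.
by rewrite !cr_scaleE; congr cr_op; apply: sfunP => w /=; rewrite mul1r.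
Qed.

Lemma cr_scaleDr : right_distributive cr_scale cr_add.
Proof.
move=> c x y; have [a [-> -> _]] := triple3_sur x y y.
rewrite cr_addE !cr_scaleE cr_addE.
by congr cr_op; apply: sfunP => w /=; rewrite mulrDr.
Qed.

Lemma cr_scaleDl x : {morph cr_scale^~ x : c d / c + d >-> cr_add c d}.
Proof.
move=> c d; have [a [-> _ _]] := triple3_sur x x x.
rewrite !cr_scaleE cr_addE.
by congr cr_op; apply: sfunP => w /=; rewrite mulrDl.
Qed.

Lemma cr_scaleAl c x y : cr_scale c (cr_mul x y) = cr_mul (cr_scale c x) y.
Proof.
have [a [-> -> _]] := triple3_sur x y y.
rewrite !cr_mulE !cr_scaleE !cr_mulE.
by congr cr_op; apply: sfunP => w /=; rewrite mulrA.
Qed.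

End UnderlyingAlgebra.

HB.instance Definition _ (R : realType) (X : cinfRing R) :=
  gen_eqMixin (cr_sort X).
HB.instance Definition _ (R : realType) (X : cinfRing R) :=
  gen_choiceMixin (cr_sort X).
HB.instance Definition _ (R : realType) (X : cinfRing R) :=
  GRing.isZmodule.Build (cr_sort X) (@cr_addA R X) (@cr_addC R X)
    (@cr_add0 R X) (@cr_addN R X).
HB.instance Definition _ (R : realType) (X : cinfRing R) :=
  GRing.Zmodule_isComPzRing.Build (cr_sort X) (@cr_mulA R X) (@cr_mulC R X)
    (@cr_mul1 R X) (@cr_mulDl R X).
HB.instance Definition _ (R : realType) (X : cinfRing R) :=
  GRing.Zmodule_isLmodule.Build R (cr_sort X) (@cr_scaleA R X)
    (@cr_scale1 R X) (@cr_scaleDr R X) (@cr_scaleDl R X).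

Section UnderlyingAlgebraTheory.
Variables (R : realType) (X : cinfRing R).

Lemma cr_opD n (f g : sfun R n) (a : 'I_n -> X) :
  cr_op f a + cr_op g a = cr_op (sadd f g) a.
Proof. exact: cr_addE. Qed.

Lemma cr_opM n (f g : sfun R n) (a : 'I_n -> X) :
  cr_op f a * cr_op g a = cr_op (smul f g) a.
Proof. exact: cr_mulE. Qed.

Lemma cr_opZ n c (f : sfun R n) (a : 'I_n -> X) :
  c *: cr_op f a = cr_op (smul (scst n c) f) a.
Proof. exact: cr_scaleE. Qed.

Lemma cr_op_cst n c (a : 'I_n -> X) : cr_op (scst n c) a = c *: (1 : X).
Proof.
rewrite /1%R /= (cr_cstE 1 a) cr_opZ.
by congr cr_op; apply: sfunP => w /=; rewrite mulr1.
Qed.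

Lemma cr_op0 n (a : 'I_n -> X) : cr_op (scst n 0) a = 0.
Proof. by rewrite cr_op_cst scale0r. Qed.

Lemma cr_op1 n (a : 'I_n -> X) : cr_op (scst n 1) a = 1.
Proof. by rewrite cr_op_cst scale1r. Qed.

Lemma cr_op_sum n m (f : 'I_m -> sfun R n) (a : 'I_n -> X) :
  cr_op (ssum f) a = \sum_j cr_op (f j) a.
Proof.
elim: m f => [|m IH] f.
  rewrite big_ord0 -(cr_op0 a); congr cr_op; apply: sfunP => w /=.
  by rewrite big_ord0.
rewrite big_ord_recl -IH cr_opD; congr cr_op; apply: sfunP => w /=.
by rewrite big_ord_recl.
Qed.

Lemma cr_scaler_mull (c : R) (x y : X) : c *: (x * y) = c *: x * y.
Proof. exact: cr_scaleAl. Qed.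

Lemma cinf_hom_linear (Y : cinfRing R) (h : X -> Y) : cinf_hom h -> linear h.
Proof.
move=> hh c x y.
have hadd u v : h (u + v) = h u + h v.
  rewrite /+%R /= /cr_add hh; congr cr_op; apply/funext => j /=.
  by rewrite /pair2; case: ifP.
by rewrite hadd; congr (_ + _); rewrite /GRing.scale /= /cr_scale hh.
Qed.

Lemma cinf_homM (Y : cinfRing R) (h : X -> Y) : cinf_hom h ->
  {morph h : x y / x * y}.
Proof.
move=> hh x y; rewrite -[x * y]/(cr_mul x y) -[h x * h y]/(cr_mul (h x) (h y)).
rewrite /cr_mul hh; congr cr_op; apply/funext => j /=.
by rewrite /pair2; case: ifP.
Qed.

Lemma cinf_hom1 (Y : cinfRing R) (h : X -> Y) : cinf_hom h -> h 1 = 1.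
Proof.
move=> hh; rewrite -[1 : X]/(cr_cst X 1) -[1 : Y]/(cr_cst Y 1) /cr_cst hh.
by congr cr_op; apply/funext => -[].
Qed.

End UnderlyingAlgebraTheory.

Record pequiv (T : Type) := PEquiv {
  pequiv_rel :> T -> T -> Prop;
  pequiv_refl : forall x, pequiv_rel x x;
  pequiv_sym : forall x y, pequiv_rel x y -> pequiv_rel y x;
  pequiv_trans : forall x y z, pequiv_rel x y -> pequiv_rel y z ->
    pequiv_rel x z }.

Section Quotient.
Variables (T : Type) (E : pequiv T).

Definition quot : Type := {A : set T | exists x, A = E x}.

Definition qpi (x : T) : quot := exist _ (pequiv_rel E x) (ex_intro _ x erefl).

Definition qrepr (q : quot) : T := sval (cid (svalP q)).

Lemma qreprK q : qpi (qrepr q) = q.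
Proof.
case: q => A hA; apply: eq_exist => /=.
by rewrite /qrepr; case: cid => x /= ->.
Qed.

Lemma qpiP x y : qpi x = qpi y <-> E x y.
Proof.
split=> [|Exy].
  by move=> /(congr1 sval) /= ->; exact: pequiv_refl.
apply: eq_exist => /=; apply/funext => z; apply/propext; split.
  by apply: pequiv_trans; exact: pequiv_sym.
exact: pequiv_trans.
Qed.

Lemma qreprP x : E (qrepr (qpi x)) x.
Proof. by apply/qpiP; rewrite qreprK. Qed.

End Quotient.

Section Tensor.
Variables (R : comNzRingType) (A B : lmodType R).

(* A (x) B is the set of formal finite sums of pairs (a, b), represented by
   sequences, modulo the congruence generated by bilinearity. *)
Inductive teq : seq (A * B) -> seq (A * B) -> Prop :=
| teq_refl s : teq s s
| teq_sym s t : teq s t -> teq t s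
| teq_trans s t u : teq s t -> teq t u -> teq s u
| teq_cat s s' t t' : teq s s' -> teq t t' -> teq (s ++ t) (s' ++ t')
| teq_catC s t : teq (s ++ t) (t ++ s)
| teq_addl a a' b : teq [:: (a + a', b)] [:: (a, b); (a', b)]
| teq_addr a b b' : teq [:: (a, b + b')] [:: (a, b); (a, b')]
| teq_scale (c : R) a b : teq [:: (c *: a, b)] [:: (a, c *: b)]
| teq_0l b : teq [:: (0, b)] [::].

Definition teq_equiv : pequiv (seq (A * B)) :=
  PEquiv teq_refl teq_sym teq_trans.

Definition tensor : Type := quot teq_equiv.

Definition tclass (s : seq (A * B)) : tensor := qpi teq_equiv s.

Definition tens (a : A) (b : B) : tensor := tclass [:: (a, b)].

Definition tadd (x y : tensor) : tensor := tclass (qrepr x ++ qrepr y).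

Definition tzero : tensor := tclass [::].

Definition tscale (c : R) (x : tensor) : tensor :=
  tclass [seq (c *: p.1, p.2) | p <- qrepr x].

Lemma tclassP s t : tclass s = tclass t <-> teq s t.
Proof. exact: qpiP. Qed.

Lemma taddE s t : tadd (tclass s) (tclass t) = tclass (s ++ t).
Proof. by apply/tclassP; apply: teq_cat; exact: (qreprP teq_equiv). Qed.

Lemma teq_map_scale c s t : teq s t ->
  teq [seq (c *: p.1, p.2) | p <- s] [seq (c *: p.1, p.2) | p <- t].
Proof.
elim=> {s t}.
- by move=> s; exact: teq_refl.
- by move=> s t _; exact: teq_sym.
- by move=> s t u _ st _; exact: teq_trans.
- by move=> s s' t t' _ ss' _ tt'; rewrite !map_cat; exact: teq_cat.
- by move=> s t; rewrite !map_cat; exact: teq_catC.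
- by move=> a a' b /=; rewrite scalerDr; exact: teq_addl.
- by move=> a b b' /=; exact: teq_addr.
- move=> d a b /=; rewrite scalerA mulrC -scalerA; exact: teq_scale.
- by move=> b /=; rewrite scaler0; exact: teq_0l.
Qed.

Lemma tscaleE c s : tscale c (tclass s) = tclass [seq (c *: p.1, p.2) | p <- s].
Proof. by apply/tclassP/teq_map_scale; exact: (qreprP teq_equiv). Qed.

Lemma tclass_ind (P : tensor -> Prop) : (forall s, P (tclass s)) -> forall x, P x.
Proof. by move=> Ps x; rewrite -(qreprK x); exact: Ps. Qed.

Lemma taddA : associative tadd.
Proof.
elim/tclass_ind=> s; elim/tclass_ind=> t; elim/tclass_ind=> u.
by rewrite !taddE catA.
Qed.

Lemma taddC : commutative tadd.
Proof.
elim/tclass_ind=> s; elim/tclass_ind=> t.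
by rewrite !taddE; apply/tclassP; exact: teq_catC.
Qed.

Lemma tadd0 : left_id tzero tadd.
Proof. by elim/tclass_ind=> s; rewrite taddE. Qed.

Lemma tscaleDr : right_distributive tscale tadd.
Proof.
move=> c; elim/tclass_ind=> s; elim/tclass_ind=> t.
by rewrite !(taddE, tscaleE) map_cat.
Qed.

Lemma tscaleA c d x : tscale c (tscale d x) = tscale (c * d) x.
Proof.
elim/tclass_ind: x => s; rewrite !tscaleE -map_comp; congr tclass.
by apply: eq_map => p /=; rewrite scalerA.
Qed.

Lemma tscale1 : left_id 1 tscale.
Proof.
elim/tclass_ind=> s; rewrite !tscaleE; congr tclass.
by rewrite -[RHS]map_id; apply: eq_map => -[a b] /=; rewrite scale1r.
Qed.

Lemma tscaleDl x : {morph tscale^~ x : c d / c + d >-> tadd c d}.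
Proof.
move=> c d; elim/tclass_ind: x => s; elim: s => [|[a b] s IH].
  by rewrite !tscaleE taddE.
rewrite -cat1s -taddE !tscaleDr IH.
have -> : tscale (c + d) (tclass [:: (a, b)]) =
   tadd (tscale c (tclass [:: (a, b)])) (tscale d (tclass [:: (a, b)])).
  by rewrite !tscaleE taddE /= scalerDl; apply/tclassP; exact: teq_addl.
rewrite -!taddA; congr tadd.
by rewrite !taddA; congr tadd; rewrite taddC.
Qed.

Lemma taddN : left_inverse tzero (tscale (-1)) tadd.
Proof.
move=> x; rewrite -[X in tadd _ X]tscale1 -tscaleDl addNr.
elim/tclass_ind: x => s; rewrite tscaleE; apply/tclassP.
elim: s => [|[a b] s IH] /=; first exact: teq_refl.
rewrite -cat1s -[X in teq _ X]cats0; rewrite scale0r; apply: (@teq_cat _ [::]) => //.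
exact: teq_0l.
Qed.

End Tensor.

HB.instance Definition _ (R : comNzRingType) (A B : lmodType R) :=
  gen_eqMixin (tensor A B).
HB.instance Definition _ (R : comNzRingType) (A B : lmodType R) :=
  gen_choiceMixin (tensor A B).
HB.instance Definition _ (R : comNzRingType) (A B : lmodType R) :=
  GRing.isZmodule.Build (tensor A B) (@taddA R A B) (@taddC R A B)
    (@tadd0 R A B) (@taddN R A B).
HB.instance Definition _ (R : comNzRingType) (A B : lmodType R) :=
  GRing.Zmodule_isLmodule.Build R (tensor A B) (@tscaleA R A B)
    (@tscale1 R A B) (@tscaleDr R A B) (@tscaleDl R A B).

Section TensorTheory.
Variables (R : comNzRingType) (A B : lmodType R).

Lemma tensDl (a a' : A) (b : B) : tens (a + a') b = tens a b + tens a' b.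
Proof. by rewrite [RHS]taddE; apply/tclassP; exact: teq_addl. Qed.

Lemma tensDr (a : A) (b b' : B) : tens a (b + b') = tens a b + tens a b'.
Proof. by rewrite [RHS]taddE; apply/tclassP; exact: teq_addr. Qed.

Lemma tensZl c (a : A) (b : B) : tens (c *: a) b = c *: tens a b.
Proof. by rewrite [RHS]tscaleE. Qed.

Lemma tensZr c (a : A) (b : B) : tens a (c *: b) = c *: tens a b.
Proof. by rewrite -tensZl; apply/tclassP; exact/teq_sym/teq_scale. Qed.

Lemma tclassE (s : seq (A * B)) : tclass s = \sum_(p <- s) tens p.1 p.2.
Proof.
elim: s => [|[a b] s IH]; first by rewrite big_nil.
by rewrite big_cons -IH -cat1s -taddE.
Qed.

Lemma tensor_ind (P : tensor A B -> Prop) : P 0 -> 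
  (forall x y, P x -> P y -> P (x + y)) -> (forall a b, P (tens a b)) ->
  forall x, P x.
Proof.
move=> P0 PD Pt; elim/tclass_ind=> s; rewrite tclassE.
by apply: big_ind => // p _; exact: Pt.
Qed.

Definition bilin (C : lmodType R) (f : A -> B -> C) : Prop :=
  (forall b, linear (f^~ b)) /\ (forall a, linear (f a)).

Lemma bilin_tens : bilin (@tens R A B).
Proof.
by split=> [b c a a'|a c b b']; rewrite ?(tensDl, tensDr) ?(tensZl, tensZr).
Qed.

(* Only meaningful for bilinear f: the value is then independent of the chosen
   representative (tlift_class). *)
Definition tlift (C : lmodType R) (f : A -> B -> C) (x : tensor A B) : C :=
  \sum_(p <- qrepr x) f p.1 p.2.

Section Lift.
Variables (C : lmodType R) (f : A -> B -> C).
Hypothesis bf : bilin f.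

Lemma bilinDl a a' b : f (a + a') b = f a b + f a' b.
Proof. by have := bf.1 b 1 a a'; rewrite !scale1r. Qed.

Lemma bilinDr a b b' : f a (b + b') = f a b + f a b'.
Proof. by have := bf.2 a 1 b b'; rewrite !scale1r. Qed.

Lemma bilin0l b : f 0 b = 0.
Proof. by apply: (addrI (f 0 b)); rewrite -bilinDl !addr0. Qed.

Lemma bilin0r a : f a 0 = 0.
Proof. by apply: (addrI (f a 0)); rewrite -bilinDr !addr0. Qed.

Lemma bilinZl c a b : f (c *: a) b = c *: f a b.
Proof. by have := bf.1 b c a 0; rewrite bilin0l !addr0. Qed.

Lemma bilinZr c a b : f a (c *: b) = c *: f a b.
Proof. by have := bf.2 a c b 0; rewrite bilin0r !addr0. Qed.

Lemma teq_sum s t : teq s t ->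
  \sum_(p <- s) f p.1 p.2 = \sum_(p <- t) f p.1 p.2.
Proof.
elim=> {s t} //.
- by move=> s t u _ -> _ ->.
- by move=> s s' t t' _ ss' _ tt'; rewrite !big_cat /= ss' tt'.
- by move=> s t; rewrite !big_cat /= addrC.
- by move=> a a' b; rewrite !big_cons big_nil /= !addr0 bilinDl.
- by move=> a b b'; rewrite !big_cons big_nil /= !addr0 bilinDr.
- by move=> c a b; rewrite !big_cons big_nil /= !addr0 bilinZl bilinZr.
- by move=> b; rewrite !big_cons big_nil /= !addr0 bilin0l.
Qed.

Lemma tlift_class s : tlift f (tclass s) = \sum_(p <- s) f p.1 p.2.
Proof. by apply: teq_sum; exact: (qreprP (teq_equiv A B)). Qed.

Lemma tliftE a b : tlift f (tens a b) = f a b.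
Proof. by rewrite tlift_class big_seq1. Qed.

Lemma tlift_linear : linear (tlift f).
Proof.
move=> c; elim/tclass_ind=> s; elim/tclass_ind=> t.
rewrite [c *: _]tscaleE [_ + _]taddE !tlift_class big_cat big_map /=.
congr (_ + _); rewrite scaler_sumr; apply: eq_bigr => p _.
by rewrite bilinZl.
Qed.

Lemma tlift_uniq (g : tensor A B -> C) : linear g ->
  (forall a b, g (tens a b) = f a b) -> g = tlift f.
Proof.
move=> lg gf; have gD x y : g (x + y) = g x + g y.
  by have := lg 1 x y; rewrite !scale1r.
have lD x y : tlift f (x + y) = tlift f x + tlift f y.
  by have := tlift_linear 1 x y; rewrite !scale1r.
apply/funext; elim/tensor_ind => [|x y IHx IHy|a b].
- have /eqP := gD 0 0; rewrite addr0 -subr_eq0 opprD addNKr oppr_eq0 => /eqP ->.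
  have /eqP := lD 0 0; rewrite addr0 -subr_eq0 opprD addNKr oppr_eq0.
  by move=> /eqP ->.
- by rewrite gD lD IHx IHy.
- by rewrite gf tliftE.
Qed.

End Lift.
End TensorTheory.

Definition tmap (R : comNzRingType) (A A' B B' : lmodType R)
    (f : {linear A -> A'}) (g : {linear B -> B'}) : tensor A B -> tensor A' B' :=
  tlift (fun a b => tens (f a) (g b)).

Section TMap.
Variables (R : comNzRingType) (A A' B B' : lmodType R).
Variables (f : {linear A -> A'}) (g : {linear B -> B'}).

Lemma tmap_bilin : bilin (fun a b => tens (f a) (g b)).
Proof.
by split=> [b c a a'|a c b b'];
  rewrite linearP ?(tensDl, tensDr) ?(tensZl, tensZr).
Qed.

Lemma tmapE a b : tmap f g (tens a b) = tens (f a) (g b).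
Proof. by rewrite /tmap (tliftE tmap_bilin). Qed.

Lemma tmap_linear : linear (tmap f g).
Proof. exact: (tlift_linear tmap_bilin). Qed.

HB.instance Definition _ := GRing.isLinear.Build R (tensor A B) (tensor A' B')
  *:%R (tmap f g) tmap_linear.

End TMap.

Section FreeCinfRing.
Variables (R : realType) (V : lmodType R).

Inductive cterm : Type :=
| CGen (v : V)
| COp n (f : sfun R n) (a : 'I_n -> cterm).

(* The congruence generated by the axioms of C^oo-rings and by the linearity of
   the insertion of generators. *)
Inductive ceq : cterm -> cterm -> Prop :=
| ceq_refl t : ceq t t
| ceq_sym t u : ceq t u -> ceq u t
| ceq_trans t u w : ceq t u -> ceq u w -> ceq t w
| ceq_op n (f : sfun R n) a b : (forall i, ceq (a i) (b i)) ->
    ceq (COp f a) (COp f b)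
| ceq_proj n (i : 'I_n) a : ceq (COp (sproj R i) a) (a i)
| ceq_comp m n (g : sfun R m) (f : 'I_m -> sfun R n) a :
    ceq (COp (scomp g f) a) (COp g (fun j => COp (f j) a))
| ceq_add u v : ceq (CGen (u + v)) (COp (sadd2 R) (pair2 (CGen u) (CGen v)))
| ceq_scale c v : ceq (CGen (c *: v)) (COp (sscale1 c) (fun=> CGen v)).

Definition ceq_equiv : pequiv cterm := PEquiv ceq_refl ceq_sym ceq_trans.

Definition Sinf_carrier : Type := quot ceq_equiv.

Definition Sinf_op n (f : sfun R n) (a : 'I_n -> Sinf_carrier) : Sinf_carrier :=
  qpi ceq_equiv (COp f (fun i => qrepr (a i))).

Lemma Sinf_opE n (f : sfun R n) (a : 'I_n -> cterm) :
  Sinf_op f (fun i => qpi ceq_equiv (a i)) = qpi ceq_equiv (COp f a).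
Proof. by apply/qpiP; apply: ceq_op => i; exact: (qreprP ceq_equiv). Qed.

Lemma Sinf_repr n (a : 'I_n -> Sinf_carrier) :
  a = (fun i => qpi ceq_equiv (qrepr (a i))).
Proof. by apply/funext => i; rewrite qreprK. Qed.

Lemma Sinf_op_proj n (i : 'I_n) (a : 'I_n -> Sinf_carrier) :
  Sinf_op (sproj R i) a = a i.
Proof.
rewrite (Sinf_repr a) Sinf_opE; apply/qpiP; exact: (ceq_proj i (fun j => qrepr (a j))).
Qed.

Lemma Sinf_op_comp m n (g : sfun R m) (f : 'I_m -> sfun R n)
    (a : 'I_n -> Sinf_carrier) :
  Sinf_op (scomp g f) a = Sinf_op g (fun j => Sinf_op (f j) a).
Proof.
rewrite (Sinf_repr a) Sinf_opE.
under [in RHS]eq_fun do rewrite Sinf_opE.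
rewrite Sinf_opE; apply/qpiP; exact: ceq_comp.
Qed.

Definition Sinf : cinfRing R := CinfRing Sinf_op_proj Sinf_op_comp.

Definition eta (v : V) : Sinf := qpi ceq_equiv (CGen v).

Lemma eta_linear : linear eta.
Proof.
move=> c u v; rewrite /+%R /= /cr_add /= /GRing.scale /= /cr_scale /=.
have -> : (fun=> eta u) = (fun=> qpi ceq_equiv (CGen u)) :> ('I_1 -> _) by [].
rewrite Sinf_opE.
have -> : pair2 (qpi ceq_equiv (COp (sscale1 c) (fun=> CGen u))) (eta v) =
  (fun i => qpi ceq_equiv (pair2 (COp (sscale1 c) (fun=> CGen u)) (CGen v) i)).
  by apply/funext => i; rewrite /pair2; case: ifP.
rewrite Sinf_opE; apply/qpiP; apply: ceq_trans; first exact: ceq_add.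
apply: ceq_op => i; rewrite /pair2; case: ifP => _; last exact: ceq_refl.
exact: ceq_scale.
Qed.

HB.instance Definition _ := GRing.isLinear.Build R V Sinf *:%R eta eta_linear.

Fixpoint ceval (X : cinfRing R) (h : V -> X) (t : cterm) : X :=
  match t with
  | CGen v => h v
  | COp n f a => cr_op f (fun i => ceval h (a i))
  end.

Lemma ceval_ceq (X : cinfRing R) (h : {linear V -> X}) t u :
  ceq t u -> ceval h t = ceval h u.
Proof.
elim=> {t u} //=.
- by move=> t u w _ -> _ ->.
- by move=> n f a b _ ab; congr cr_op; apply/funext => i.
- by move=> n i a; rewrite cr_proj.
- by move=> m n g f a; rewrite cr_comp.
- move=> u v; rewrite linearD [LHS]/+%R /= /cr_add; congr cr_op.
  by apply/funext => i; rewrite /pair2; case: ifP.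
- by move=> c v; rewrite linearZ.
Qed.

Definition Sinf_lift (X : cinfRing R) (h : {linear V -> X}) (x : Sinf) : X :=
  ceval h (qrepr x).

Section Lift.
Variables (X : cinfRing R) (h : {linear V -> X}).

Lemma Sinf_liftE t : Sinf_lift h (qpi ceq_equiv t) = ceval h t.
Proof. by apply: ceval_ceq; exact: (qreprP ceq_equiv). Qed.

Lemma Sinf_lift_eta v : Sinf_lift h (eta v) = h v.
Proof. by rewrite Sinf_liftE. Qed.

Lemma Sinf_lift_hom : cinf_hom (Sinf_lift h).
Proof.
move=> n f a; rewrite (Sinf_repr a) /= Sinf_opE Sinf_liftE /=.
by congr cr_op; apply/funext => i /=; rewrite Sinf_liftE.
Qed.

Lemma Sinf_lift_uniq (g : Sinf -> X) : cinf_hom g ->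
  (forall v, g (eta v) = h v) -> g = Sinf_lift h.
Proof.
move=> hg geta; apply/funext => x; rewrite -(qreprK x) Sinf_liftE.
elim: (qrepr x) => [v|n f a IH] /=; first exact: geta.
rewrite -Sinf_opE; have := hg n f (fun i => qpi ceq_equiv (a i)).
by rewrite /= => ->; congr cr_op; apply/funext => i /=.
Qed.

HB.instance Definition _ := GRing.isLinear.Build R Sinf X *:%R (Sinf_lift h)
  (cinf_hom_linear Sinf_lift_hom).

End Lift.

Theorem Sinf_free (X : cinfRing R) (h : {linear V -> X}) :
  exists! g : Sinf -> X, cinf_hom g /\ (forall v, g (eta v) = h v).
Proof.
exists (Sinf_lift h); split=> [|g [hg geta]].
  by split; [exact: Sinf_lift_hom|exact: Sinf_lift_eta].
by rewrite (Sinf_lift_uniq hg geta).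
Qed.

Lemma Sinf_ind_cterm (P : Sinf -> Prop) : (forall v, P (eta v)) ->
  (forall n (f : sfun R n) a, (forall i, P (a i)) -> P (cr_op f a)) ->
  forall x, P x.
Proof.
move=> Pe Po x; rewrite -(qreprK x); elim: (qrepr x) => [v|n f a IH]; first exact: Pe.
by rewrite -Sinf_opE; exact: Po.
Qed.

End FreeCinfRing.

Definition Smap (R : realType) (V W : lmodType R) (h : {linear V -> W}) :
    Sinf V -> Sinf W :=
  Sinf_lift (@eta R W \o h).

HB.instance Definition _ (R : realType) (V W : lmodType R)
    (h : {linear V -> W}) :=
  GRing.isLinear.Build R (Sinf V) (Sinf W) *:%R (Smap h)
    (linearP (Sinf_lift (@eta R W \o h))).

Lemma Smap_hom (R : realType) (V W : lmodType R) (h : {linear V -> W}) :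
  cinf_hom (Smap h).
Proof. exact: Sinf_lift_hom. Qed.

Lemma Smap_eta (R : realType) (V W : lmodType R) (h : {linear V -> W}) v :
  Smap h (eta v) = eta (h v).
Proof. exact: Sinf_lift_eta. Qed.

Section PointAlgebra.
Variable R : realType.

Definition pt_op n (f : sfun R n) (a : 'I_n -> R) : R := f (\row_i a i).

Lemma pt_op_proj n (i : 'I_n) (a : 'I_n -> R) : pt_op (sproj R i) a = a i.
Proof. by rewrite /pt_op /= mxE. Qed.

Lemma pt_op_comp m n (g : sfun R m) (f : 'I_m -> sfun R n) (a : 'I_n -> R) :
  pt_op (scomp g f) a = pt_op g (fun j => pt_op (f j) a).
Proof. by []. Qed.

Definition Rcinf : cinfRing R := CinfRing pt_op_proj pt_op_comp.

End PointAlgebra.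

Lemma Sinf_oner_neq0 (R : realType) (V : lmodType R) : (1 : Sinf V) != 0.
Proof.
apply/eqP => /(congr1 (Sinf_lift (\0 : {linear V -> Rcinf R}))).
rewrite [in LHS]/1%R [in RHS]/0%R /= /cr_cst /=.
have H := @Sinf_lift_hom R V (Rcinf R) \0.
rewrite !(H 0) /= /pt_op /= => /eqP; apply/negP; exact: oner_neq0.
Qed.

HB.instance Definition _ (R : realType) (V : lmodType R) :=
  GRing.PzSemiRing_isNonZero.Build (cr_sort (Sinf V)) (@Sinf_oner_neq0 R V).
HB.instance Definition _ (R : realType) (V : lmodType R) :=
  GRing.Lmodule_isLalgebra.Build R (cr_sort (Sinf V)) (@cr_scaler_mull R (Sinf V)).
HB.instance Definition _ (R : realType) (V : lmodType R) :=
  GRing.Lalgebra_isComAlgebra.Build R (cr_sort (Sinf V)).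


(* The element of S^oo(R^n) corresponding to f under the identification
   S^oo(R^n) = C^oo(R^n), i.e. Phi_f (eta e_1, ..., eta e_n). *)
Definition of_sfun (R : realType) n (f : sfun R n) : Sinf 'rV[R]_n :=
  cr_op f (fun i => eta (delta_mx 0 i)).

Section SfunRing.
Variables (R : realType) (n : nat).

Lemma scomp_proj m (i : 'I_m) (a : 'I_m -> sfun R n) : scomp (sproj R i) a = a i.
Proof. by apply: sfunP => x /=; rewrite mxE. Qed.

Lemma scompA m k (g : sfun R m) (f : 'I_m -> sfun R k) (a : 'I_k -> sfun R n) :
  scomp (scomp g f) a = scomp g (fun j => scomp (f j) a).
Proof. exact: sfunP. Qed.

Definition Cinf : cinfRing R :=
  @CinfRing R (sfun R n) (fun m g f => scomp g f) scomp_proj scompA.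

Lemma of_sfun_hom : cinf_hom (@of_sfun R n : Cinf -> Sinf 'rV[R]_n).
Proof. by move=> m g f; exact: cr_comp. Qed.

Lemma of_sfun_proj i : of_sfun (sproj R i) = eta (delta_mx 0 i : 'rV[R]_n).
Proof. exact: cr_proj. Qed.

Lemma of_sfun_bij : bijective (@of_sfun R n).
Proof.
pose h (v : 'rV[R]_n) : Cinf := \sum_i v 0 i *: (sproj R i : Cinf).
have lh : linear h.
  move=> c u v; rewrite /h scaler_sumr -big_split /=; apply: eq_bigr => i _.
  by rewrite !mxE scalerDl scalerA.
pose hl : {linear 'rV[R]_n -> Cinf} :=
  HB.pack h (GRing.isLinear.Build _ _ _ _ _ lh).
have he i : hl (delta_mx 0 i) = sproj R i.
  rewrite -[LHS]/(h _) /h (bigD1 i) // mxE !eqxx scale1r big1; first exact: addr0.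
  by move=> j ji; rewrite mxE (negbTE ji) andbF scale0r.
exists (Sinf_lift hl) => [f|x].
  rewrite /of_sfun Sinf_lift_hom /=; apply: sfunP => x /=; congr (sfun_val f _).
  by apply/rowP => i; rewrite mxE /= Sinf_lift_eta he.
have idE : (@of_sfun R n) \o Sinf_lift hl = Sinf_lift (@eta R 'rV[R]_n).
  apply: Sinf_lift_uniq => [m f a /=|v /=]; first by rewrite Sinf_lift_hom of_sfun_hom.
  have lin := cinf_hom_linear of_sfun_hom.
  pose ol : {linear Cinf -> Sinf 'rV[R]_n} :=
    HB.pack (@of_sfun R n : Cinf -> _) (GRing.isLinear.Build _ _ _ _ _ lin).
  rewrite Sinf_lift_eta -[LHS]/(ol (h v)) /h linear_sum.
  rewrite [in RHS](row_sum_delta v) linear_sum; apply: eq_bigr => i _.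
  by rewrite !linearZ /= of_sfun_proj.
have idE' : id = Sinf_lift (@eta R 'rV[R]_n) by exact: Sinf_lift_uniq.
by have /= := congr1 (fun f => f x) idE; rewrite -idE'.
Qed.

End SfunRing.

Definition is_dtransf (R : realType)
    (d : forall V : lmodType R, {linear Sinf V -> tensor (Sinf V) V}) : Prop :=
  (forall (V W : lmodType R) (h : {linear V -> W}) (x : Sinf V),
     tmap (Smap h) h (d V x) = d W (Smap h x)) /\
  (forall n (f : sfun R n),
     d 'rV[R]_n (of_sfun f) =
     \sum_(i < n) tens (of_sfun (spartial i f)) (delta_mx 0 i)).

Section DualNumbers.
Variables (R : realType) (X : cinfRing R) (W : lmodType R).

Lemma tens_act_bilin (a : X) : bilin (fun (b : X) (w : W) => tens (a * b) w).
Proof.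
split=> [w c b b'|b c w w'].
  by rewrite mulrDr [a * (c *: b)]mulrC -cr_scaler_mull [b * a]mulrC tensDl tensZl.
by rewrite tensDr tensZr.
Qed.

Definition tact (a : X) (z : tensor X W) : tensor X W :=
  tlift (fun b w => tens (a * b) w) z.

Lemma tactE a b w : tact a (tens b w) = tens (a * b) w.
Proof. exact: (tliftE (tens_act_bilin a)). Qed.

Lemma tact_linear a : linear (tact a).
Proof. exact: (tlift_linear (tens_act_bilin a)). Qed.

HB.instance Definition _ a := GRing.isLinear.Build R (tensor X W) (tensor X W)
  *:%R (tact a) (tact_linear a).

Lemma tactDl a b z : tact (a + b) z = tact a z + tact b z.
Proof.
elim/tensor_ind: z => [|x y IHx IHy|c w]; rewrite ?linear0 ?addr0 //.
  by rewrite !linearD /= IHx IHy /= addrACA.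
by rewrite !tactE mulrDl tensDl.
Qed.

Lemma tactM a b z : tact (a * b) z = tact a (tact b z).
Proof.
elim/tensor_ind: z => [|x y IHx IHy|c w]; rewrite ?linear0 //.
  by rewrite !linearD /= IHx IHy.
by rewrite !tactE mulrA.
Qed.

Lemma tactZl k a z : tact (k *: a) z = k *: tact a z.
Proof.
elim/tensor_ind: z => [|x y IHx IHy|c w]; rewrite ?linear0 ?scaler0 //.
  by rewrite !linearD /= IHx IHy.
by rewrite !tactE -cr_scaler_mull tensZl.
Qed.

Lemma tact1 z : tact 1 z = z.
Proof.
elim/tensor_ind: z => [|x y IHx IHy|c w]; rewrite ?linear0 //.
  by rewrite !linearD /= IHx IHy.
by rewrite !tactE mul1r.
Qed.

Lemma tact0 z : tact 0 z = 0.
Proof. by rewrite -(scale0r 0) tactZl scale0r. Qed.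

Lemma tact_suml m (a : 'I_m -> X) z : tact (\sum_j a j) z = \sum_j tact (a j) z.
Proof.
elim: m a => [|m IH] a; first by rewrite !big_ord0 tact0.
by rewrite !big_ord_recl tactDl IH.
Qed.

(* X (+) (X (x) W) with Phi_f (a + m) = Phi_f(a) + sum_i Phi_{d_i f}(a) m_i *)
Definition dual_op n (f : sfun R n) (p : 'I_n -> X * tensor X W) :
    X * tensor X W :=
  (cr_op f (fun i => (p i).1),
   \sum_i tact (cr_op (spartial i f) (fun j => (p j).1)) (p i).2).

Lemma dual_proj n (i : 'I_n) (p : 'I_n -> X * tensor X W) :
  dual_op (sproj R i) p = p i.
Proof.
rewrite /dual_op cr_proj (bigD1 i) //= spartial_proj eqxx cr_op1 tact1.
rewrite big1 ?addr0 => [|j ji]; first by case: (p i).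
by rewrite spartial_proj eq_sym (negbTE ji) cr_op0 tact0.
Qed.

Lemma dual_comp m n (g : sfun R m) (f : 'I_m -> sfun R n)
    (p : 'I_n -> X * tensor X W) :
  dual_op (scomp g f) p = dual_op g (fun j => dual_op (f j) p).
Proof.
rewrite /dual_op /= cr_comp; congr (_, _).
under [RHS]eq_bigr do rewrite linear_sum.
rewrite exchange_big /=; apply: eq_bigr => i _.
rewrite spartial_comp cr_op_sum tact_suml; apply: eq_bigr => j _.
by rewrite -cr_opM cr_comp tactM.
Qed.

Definition dual : cinfRing R := CinfRing dual_proj dual_comp.

Lemma dualD (p q : dual) : p + q = (p.1 + q.1, p.2 + q.2) :> X * tensor X W.
Proof.
rewrite [p + q]/(cr_add p q) /cr_add /= /dual_op !big_ord_recl big_ord0 addr0.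
congr (_, _).
  by rewrite [RHS]/(cr_add p.1 q.1) /cr_add; congr cr_op; apply/funext => i;
     rewrite /pair2; case: ifP.
rewrite /= !spartialD !spartial_proj /= -!cr_opD.
by rewrite !cr_op1 !cr_op0 addr0 add0r !tact1.
Qed.

Lemma dualZ c (p : dual) : c *: p = (c *: p.1, c *: p.2) :> X * tensor X W.
Proof.
rewrite [c *: p]/(cr_scale c p) /cr_scale /= /dual_op big_ord_recl big_ord0 addr0.
congr (_, _).
rewrite /= spartialM spartial_cst spartial_proj /= -!cr_opD -!cr_opM.
by rewrite cr_op1 cr_op0 mulr1 mulr0 addr0 cr_op_cst tactZl tact1.
Qed.

End DualNumbers.

Section DExists.
Variable R : realType.

Section Component.
Variable V : lmodType R.
Let D := dual (Sinf V) V.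

Definition dgen (v : V) : D := (eta v, tens 1 v).

Lemma dgen_linear : linear dgen.
Proof.
move=> c u v; rewrite /dgen; apply/esym; rewrite (dualD _ _) (dualZ _ _) /=.
by rewrite linearP tensDr tensZr.
Qed.

HB.instance Definition _ := GRing.isLinear.Build R V D *:%R dgen dgen_linear.

Definition dcomp (x : Sinf V) : tensor (Sinf V) V := (Sinf_lift dgen x).2.

Lemma dcomp_linear : linear dcomp.
Proof.
move=> c x y.
rewrite /dcomp linearP (dualD _ _) /=; congr (_ + _).
exact: (congr1 snd (dualZ c (Sinf_lift dgen x))).
Qed.

HB.instance Definition _ := GRing.isLinear.Build R (Sinf V) (tensor (Sinf V) V)
  *:%R dcomp dcomp_linear.

Lemma dcomp_fst x : (Sinf_lift dgen x).1 = x.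
Proof.
have e1 : (fun x => (Sinf_lift dgen x).1) = Sinf_lift (@eta R V).
  by apply: Sinf_lift_uniq => [n f a|v]; rewrite ?Sinf_lift_hom ?Sinf_lift_eta.
have e2 : id = Sinf_lift (@eta R V) by exact: Sinf_lift_uniq.
by rewrite [LHS](congr1 (fun f => f x) e1) -e2.
Qed.

Lemma dcomp_eta v : dcomp (eta v) = tens 1 v.
Proof. by rewrite /dcomp Sinf_lift_eta. Qed.

Lemma dcomp_op n (f : sfun R n) (a : 'I_n -> Sinf V) :
  dcomp (cr_op f a) = \sum_i tact (cr_op (spartial i f) a) (dcomp (a i)).
Proof.
rewrite /dcomp Sinf_lift_hom /=; apply: eq_bigr => i _; congr (tact (cr_op _ _) _).
by apply/funext => j; exact: dcomp_fst.
Qed.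

End Component.

Lemma tmap_tact (V W : lmodType R) (h : {linear V -> W}) a z :
  tmap (Smap h) h (tact a z) = tact (Smap h a) (tmap (Smap h) h z).
Proof.
elim/tensor_ind: z => [|x y IHx IHy|b v]; rewrite ?linear0 //.
  by rewrite !linearD /= IHx IHy.
by rewrite !(tactE, tmapE) /= (cinf_homM (Smap_hom h)).
Qed.

Lemma dcomp_natural (V W : lmodType R) (h : {linear V -> W}) (x : Sinf V) :
  tmap (Smap h) h (dcomp x) = dcomp (Smap h x).
Proof.
elim/Sinf_ind_cterm: x => [v|n f a IH].
  by rewrite dcomp_eta tmapE /= Smap_eta dcomp_eta (cinf_hom1 (Smap_hom h)).
rewrite Smap_hom !dcomp_op linear_sum; apply: eq_bigr => i _.
by rewrite /= tmap_tact IH Smap_hom.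
Qed.

Lemma dcomp_of_sfun n (f : sfun R n) :
  dcomp (of_sfun f) = \sum_(i < n) tens (of_sfun (spartial i f)) (delta_mx 0 i).
Proof.
rewrite dcomp_op; apply: eq_bigr => i _.
by rewrite dcomp_eta tactE mulr1.
Qed.

Lemma dcomp_is_dtransf : is_dtransf (fun V => @dcomp V : {linear _ -> _}).
Proof. by split; [exact: dcomp_natural|exact: dcomp_of_sfun]. Qed.

Lemma Sinf_of_sfun (V : lmodType R) (x : Sinf V) :
  exists n (h : {linear 'rV[R]_n -> V}) (f : sfun R n), x = Smap h (of_sfun f).
Proof.
suff [n [v [f ->]]] : exists n (v : 'I_n -> V) (f : sfun R n),
    x = cr_op f (fun i => eta (v i)).
  pose h (w : 'rV[R]_n) : V := \sum_i w 0 i *: v i.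
  have lh : linear h.
    move=> c u w; rewrite /h scaler_sumr -big_split /=; apply: eq_bigr => i _.
    by rewrite !mxE scalerDl scalerA.
  pose hl : {linear 'rV[R]_n -> V} :=
    HB.pack h (GRing.isLinear.Build _ _ _ _ _ lh).
  exists n, hl, f; rewrite /of_sfun /Smap Sinf_lift_hom; congr cr_op.
  apply/funext => i /=; rewrite Sinf_lift_eta /= /h (bigD1 i) //= mxE !eqxx.
  rewrite scale1r big1 ?addr0 // => j ji.
  by rewrite mxE (negbTE ji) andbF scale0r.
elim/Sinf_ind_cterm: x => [v|n f a IH].
  by exists 1, (fun=> v), (sproj R 0); rewrite cr_proj.
pose m i := sval (cid (IH i)); pose mP i := svalP (cid (IH i)).
pose v i := sval (cid (mP i)); pose vP i := svalP (cid (mP i)).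
pose g i := sval (cid (vP i)).
have ag i : a i = cr_op (g i) (fun k => eta (v i k)) := svalP (cid (vP i)).
pose T := {i : 'I_n & 'I_(m i)}.
pose N := #|{: T}|.
pose F i : sfun R N :=
  scomp (g i) (fun k => sproj R (enum_rank (Tagged (fun i => 'I_(m i)) k : T))).
exists N, (fun l => let t := enum_val l : T in v (tag t) (tagged t)), (scomp f F).
rewrite cr_comp; congr cr_op; apply/funext => i; rewrite ag /F cr_comp.
by congr cr_op; apply/funext => k; rewrite cr_proj enum_rankK.
Qed.

Lemma is_dtransf_uniq d d' : @is_dtransf R d -> is_dtransf d' ->
  forall V x, d V x = d' V x.
Proof.
move=> [dn df] [dn' df'] V x; have [n [h [f ->]]] := Sinf_of_sfun x.
by rewrite -dn -dn' df df'.
Qed.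

Theorem dtransf_exists :
  exists d : forall V : lmodType R, {linear Sinf V -> tensor (Sinf V) V},
    is_dtransf d /\ forall d', is_dtransf d' -> forall V x, d' V x = d V x.
Proof.
exists (fun V => @dcomp V : {linear _ -> _}); split; first exact: dcomp_is_dtransf.
by move=> d' d'P; exact: is_dtransf_uniq d'P dcomp_is_dtransf.
Qed.

End DExists.

Definition dtransf (R : realType) :
    forall V : lmodType R, {linear Sinf V -> tensor (Sinf V) V} :=
  sval (cid (@dtransf_exists R)).

Lemma dtransfP (R : realType) : is_dtransf (@dtransf R).
Proof. by rewrite /dtransf; case: cid => d []. Qed.

Section SPTransformations.
Variables (R : realType) (V : lmodType R).

Lemma mul_bilin : bilin (fun x y : Sinf V => x * y).
Proof.
by split=> [b c a a'|a c b b']; [rewrite mulrDl scalerAl|rewrite mulrDr scalerAr].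
Qed.

Definition mtransf : tensor (Sinf V) (Sinf V) -> Sinf V :=
  tlift (fun x y => x * y).

Definition dcirc (z : tensor (Sinf V) V) : Sinf V :=
  mtransf (tmap idfun (@eta R V) z).

Definition Ktransf (x : Sinf V) : Sinf V :=
  dcirc (dtransf V x) + Smap (\0 : {linear V -> V}) x.

End SPTransformations.

Section KFormula.
Variable R : realType.
Implicit Types V W : lmodType R.

Lemma dcircE V a (v : V) : dcirc (tens a v) = a * eta v.
Proof. by rewrite /dcirc tmapE /= /mtransf (tliftE (mul_bilin V)). Qed.

Lemma dcirc_linear V : linear (@dcirc R V).
Proof.
move=> c x y; rewrite /dcirc linearP /=.
exact: (tlift_linear (mul_bilin V)).
Qed.

HB.instance Definition _ V := GRing.isLinear.Build R (tensor (Sinf V) V)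
  (Sinf V) *:%R (@dcirc R V) (@dcirc_linear V).

Lemma Ktransf_of_sfun n (f : sfun R n) :
  Ktransf (of_sfun f) =
  of_sfun (sadd (ssum (fun i => smul (spartial i f) (sproj R i))) (scst n (f 0))).
Proof.
rewrite [LHS]/Ktransf (dtransfP R).2 linear_sum /= [RHS]/of_sfun -cr_opD cr_op_sum.
apply: (congr2 (fun x y : Sinf _ => x + y)).
  by apply: eq_bigr => i _; rewrite dcircE -cr_opM cr_proj.
rewrite /of_sfun Smap_hom.
have -> : scst n (f 0) = scomp f (fun i => scst n 0).
  apply: sfunP => x /=; congr (sfun_val f _).
  by apply/rowP => i; rewrite !mxE.
rewrite cr_comp; congr cr_op; apply/funext => i /=.
rewrite Smap_eta /= linear0; exact: (esym (cr_op0 (fun i => eta (delta_mx 0 i : 'rV[R]_n)))).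
Qed.

End KFormula.

(* K is a natural isomorphism, so the partial inverse 'pinv_ is its genuine
   two-sided inverse and the default value 0 is never used. *)
Definition Kinv (R : realType) (V : lmodType R) : Sinf V -> Sinf V :=
  'pinv_(fun=> 0) setT (@Ktransf R V).

Definition stransf (R : realType) (V : lmodType R) (z : tensor (Sinf V) V) :
    Sinf V :=
  Kinv (dcirc z).

Definition line (R : realType) (V : lmodType R) (v : V) (c : R^o) : V := c *: v.

Lemma line_linear (R : realType) (V : lmodType R) (v : V) : linear (line v).
Proof. by move=> c a b; rewrite /line scalerDl -scalerA. Qed.

HB.instance Definition _ (R : realType) (V : lmodType R) (v : V) :=
  GRing.isLinear.Build R R^o V *:%R (line v) (line_linear v).

(* s_V o (1 (x) v), precomposed with the inverse unitor
   S^oo(V) -> S^oo(V) (x) R, x |-> x (x) 1. *)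
Definition Pop (R : realType) (V : lmodType R) (v : V) (x : Sinf V) : Sinf V :=
  stransf (tmap idfun (line v) (tens x (1 : R^o))).

Definition rota_baxter (k : comNzRingType) (A : comAlgType k) (P : A -> A) :
    Prop :=
  linear P /\ (forall a b : A, P a * P b = P (a * P b) + P (P a * b)).

(* Main.v *)
From HB Require Import structures.
From mathcomp Require Import all_boot all_order all_algebra.
From mathcomp Require Import all_classical all_reals all_analysis.
From mathcomp Require Import ring.
Require Import Defs.

(* On C^oo(R^n), K is E + ev_0 with E = sum_i x_i d_i the Euler field. Averaging
   along rays, (A g)(w) = int_0^1 g(t w) dt, inverts 1 + E, so Hadamard's formula
   g = g(0) + sum_i x_i A(d_i g) gives K (g(0) + sum_i x_i A(A(d_i g))) = g; and
   E f = 0 forces f to be constant along rays. Hence K is bijective on R^n, and on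
   an arbitrary V because linear maps R^n -> V have generalized inverses.
   Now K (P_v a) = a v, and P_v a vanishes at the origin, so E (P_v a) = a v. As E
   is a derivation and K = E on elements vanishing at the origin,
   K (P_v a P_v b) = P_v a (b v) + P_v b (a v) = K (P_v (a P_v b) + P_v (P_v a b)),
   and K is injective. *)

Set Implicit Arguments.
Unset Strict Implicit.
Unset Printing Implicit Defensive.

Import Order.TTheory GRing.Theory Num.Theory.
Import numFieldNormedType.Exports.

Local Open Scope classical_set_scope.
Local Open Scope ring_scope.

(** * First- and second-order estimates on balls of R^n *)

Section RayAverage.
Variable R : realType.

Lemma coord_le_norm n (x : 'rV[R]_n) i : `|x 0 i| <= `|x|.
Proof.
have /mapP[j _ ->] : `|x 0 i| \in [seq `|x p.1 p.2| | p : 'I_1 * 'I_n].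
  by apply/mapP; exists (ord0, i) => //=; rewrite mem_enum.
by rewrite [leRHS]/Num.norm /= mx_normrE; apply/bigmax_geP; right => /=; exists j.
Qed.

Lemma sfun_continuous n (g : sfun R n) : continuous g.
Proof. by move=> x; exact/differentiable_continuous/sfun_differentiable. Qed.

Lemma sfun_bounded_ball n (g : sfun R n) M :
  exists2 C, 0 <= C & forall x : 'rV[R]_n, `|x| <= M -> `|g x| <= C.
Proof.
pose A := [set x : 'rV[R]_n | `|x| <= M].
have cA : compact A.
  apply: bounded_closed_compact.
    by exists M; split; [exact: num_real|move=> y My x Ax; exact: le_trans Ax (ltW My)].
  have -> : A = (fun x : 'rV[R]_n => `|x|) @^-1` [set y | y <= M] by [].
  apply: preimage_closed; last exact: closed_le.
  by move=> x _; exact: norm_continuous.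
have /compact_bounded[C [_ HC]] : compact (g @` A).
  apply: continuous_compact cA; apply: continuous_subspaceT; exact: sfun_continuous.
(* Boundedness supplies the estimate for every real strictly above [C]; the absolute value makes the
   chosen one nonnegative. *)
exists (`|C| + 1) => [|x Ax]; first by rewrite addr_ge0.
by apply: (HC (`|C| + 1)); [rewrite (le_lt_trans (ler_norm C))// ltrDl|exists x].
Qed.

Lemma derive_sum_partial n (g : sfun R n) x u :
  'D_u g x = \sum_i u 0 i * spartial i g x.
Proof.
rewrite deriveE; last exact: sfun_differentiable.
rewrite {1}(row_sum_delta u) linear_sum; apply: eq_bigr => i _.
by rewrite linearZ /= deriveE //; exact: sfun_differentiable.
Qed.

Lemma is_derive_line n (g : sfun R n) a u (t : R) :
  is_derive t 1 (fun s : R => g (a + s *: u))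
    (\sum_i u 0 i * spartial i g (a + t *: u)).
Proof.
rewrite -derive_sum_partial.
have dl : is_diff t (fun s : R => a + s *: u) (fun s : R => s *: u).
  by apply: is_diff_eq; rewrite add0r.
have dc : differentiable (fun s : R => g (a + s *: u)) t.
  by apply: differentiable_comp => //; exact: sfun_differentiable.
split; first exact/derivable1_diffP.
rewrite deriveE// (_ : (fun s : R => g _) = g \o (fun s : R => a + s *: u))//.
rewrite diff_comp//=; last exact: sfun_differentiable.
rewrite diff_val scale1r deriveE//; exact: sfun_differentiable.
Qed.

Lemma is_derive_ray n (g : sfun R n) w (t : R) :
  is_derive t 1 (fun s : R => g (s *: w))
    (\sum_i w 0 i * spartial i g (t *: w)).
Proof.
have := is_derive_line g 0 w t; rewrite add0r.
by rewrite (_ : (fun s => g (0 + _)) = fun s => g (s *: w))//;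
   apply/funext => s; rewrite add0r.
Qed.

Lemma MVT_le (f df : R -> R) (C : R) :
  (forall t : R, is_derive t 1 f (df t)) ->
  (forall t, 0 <= t <= 1 -> `|df t| <= C) -> `|f 1 - f 0| <= C.
Proof.
move=> fd dC; have cf : {within `[0, 1], continuous f}.
  by apply: derivable_within_continuous => t _; have [] := fd t.
have [c c01 ->] := MVT_segment ler01 (fun x _ => fd x) cf.
by rewrite subr0 mulr1; apply: dC; rewrite in_itv /= in c01.
Qed.

Lemma segment_norm_le n (x u : 'rV[R]_n) M t : `|x| <= M -> `|x + u| <= M ->
  0 <= t <= 1 -> `|x + t *: u| <= M.
Proof.
move=> xM xuM /andP[t0 t1].
have -> : x + t *: u = (1 - t) *: x + t *: (x + u).
  by rewrite scalerBl scale1r scalerDr addrA subrK.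
rewrite (le_trans (ler_normD _ _))// !normrZ (ger0_norm t0) ger0_norm ?subr_ge0//.
have -> : M = (1 - t) * M + t * M by ring.
by rewrite lerD// ler_wpM2l// subr_ge0.
Qed.

(** Balls are convex, so the mean value inequality applies on the segment from [x] to [x + u], where
    each partial derivative is bounded by compactness. *)
Lemma sfun_lipschitz n (g : sfun R n) M : exists2 C, 0 <= C &
  forall x u : 'rV[R]_n, `|x| <= M -> `|x + u| <= M -> `|g (x + u) - g x| <= C * `|u|.
Proof.
have /choice[C HC] (i : 'I_n) : exists C, 0 <= C /\
    forall x : 'rV[R]_n, `|x| <= M -> `|spartial i g x| <= C.
  by have [C C0 HC] := sfun_bounded_ball (spartial i g) M; exists C.
exists (\sum_i C i) => [|x u xM xuM]; first by rewrite sumr_ge0// => i _; have [] := HC i.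
have /MVT_le := is_derive_line g x u.
rewrite scale1r scale0r addr0; apply => t t01.
rewrite (le_trans (ler_norm_sum _ _ _))// mulr_suml ler_sum// => i _.
rewrite normrM mulrC ler_pM ?coord_le_norm//.
by have [_] := HC i; apply; exact: segment_norm_le.
Qed.

(** One constant serves the whole ball; this uniformity is what later permits differentiation under
    the integral. Subtracting the linear part turns the derivative along the segment into
    differences of partials, which are Lipschitz. *)
Lemma sfun_taylor n (g : sfun R n) M : exists2 C, 0 <= C &
  forall x u : 'rV[R]_n, `|x| <= M -> `|x + u| <= M ->
    `|g (x + u) - g x - \sum_i u 0 i * spartial i g x| <= C * `|u| ^+ 2.
Proof.
have /choice[C HC] (i : 'I_n) : exists C, 0 <= C /\ forall x u : 'rV[R]_n,
    `|x| <= M -> `|x + u| <= M ->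
    `|spartial i g (x + u) - spartial i g x| <= C * `|u|.
  by have [C C0 HC] := sfun_lipschitz (spartial i g) M; exists C.
exists (\sum_i C i) => [|x u xM xuM]; first by rewrite sumr_ge0// => i _; have [] := HC i.
pose D := \sum_i u 0 i * spartial i g x.
have dl (t : R) : is_derive t 1 (fun s : R => g (x + s *: u) - s * D)
    (\sum_i u 0 i * (spartial i g (x + t *: u) - spartial i g x)).
  have := is_derive_line g x u t => dg.
  apply: is_derive_eq; rewrite scaler0 add0r /GRing.scale /= mulr1 /D -sumrB.
  by apply: eq_bigr => i _; rewrite mulrBr.
have := MVT_le dl; rewrite scale1r scale0r addr0 mul1r mul0r subr0 addrAC; apply.
move=> t t01; rewrite (le_trans (ler_norm_sum _ _ _))// mulr_suml ler_sum// => i _.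
rewrite normrM expr2 mulrA mulrC ler_pM ?coord_le_norm//.
have /andP[t0 t1] := t01; have [C0 /(_ x (t *: u) xM)] := HC i.
move=> /(_ (segment_norm_le xM xuM t01)) /le_trans; apply.
by rewrite ler_wpM2l// normrZ ger0_norm// ler_piMl.
Qed.

(** * Integration of continuous functions over [0, 1] *)

Definition int01 (f : R -> R) : R :=
  Rintegral (@lebesgue_measure R) `[0, 1] f.

Lemma integrable01 (f : R -> R) : continuous f ->
  (@lebesgue_measure R).-integrable `[0, 1] (EFin \o f).
Proof.
move=> cf; apply: continuous_compact_integrable; first exact: segment_compact.
exact: continuous_subspaceT.
Qed.

Lemma int01D (f g : R -> R) : continuous f -> continuous g ->
  int01 (fun t => f t + g t) = int01 f + int01 g.
Proof. by move=> cf cg; rewrite /int01 RintegralD//; exact: integrable01. Qed.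

Lemma int01B (f g : R -> R) : continuous f -> continuous g ->
  int01 (fun t => f t - g t) = int01 f - int01 g.
Proof. by move=> cf cg; rewrite /int01 RintegralB//; exact: integrable01. Qed.

Lemma int01Z c (f : R -> R) : continuous f ->
  int01 (fun t => c * f t) = c * int01 f.
Proof. by move=> cf; rewrite /int01 RintegralZl//; exact: integrable01. Qed.

Lemma continuous_sumR n (f : 'I_n -> R -> R) :
  (forall i, continuous (f i)) -> continuous (fun t => \sum_i f i t).
Proof.
elim: n f => [|n IH] f cf t.
  by under eq_fun do rewrite big_ord0; exact: cvg_cst.
under eq_fun do rewrite big_ord_recl.
by apply: continuousD; [exact: cf|apply: IH].
Qed.

Lemma int01_sum n (f : 'I_n -> R -> R) : (forall i, continuous (f i)) ->
  int01 (fun t => \sum_i f i t) = \sum_i int01 (f i).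
Proof.
elim: n f => [|n IH] f cf.
  rewrite big_ord0; under eq_fun do rewrite big_ord0.
  by rewrite /int01 Rintegral_cst// mul0r.
rewrite big_ord_recl -IH//; under eq_fun do rewrite big_ord_recl.
by rewrite int01D//; apply: continuous_sumR => i.
Qed.

Lemma int01_le (f : R -> R) (C : R) : continuous f ->
  (forall t, 0 <= t <= 1 -> `|f t| <= C) -> `|int01 f| <= C.
Proof.
move=> cf fC; rewrite (le_trans (le_normr_Rintegral _ (integrable01 cf)))//.
have -> : C = int01 (cst C).
  by rewrite /int01 Rintegral_cst//= lebesgue_measure_itv/= lte01/= subr0 mulr1.
apply: le_Rintegral => //.
- by apply: integrable01 => t; apply: cvg_norm; exact: cf.
- by apply: integrable01; exact: cst_continuous.
Qed.

Lemma int01_FTC (f df : R -> R) : (forall t : R, is_derive t 1 f (df t)) ->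
  continuous df -> int01 df = f 1 - f 0.
Proof.
move=> fd cdf.
have cf : continuous f.
  by move=> t; apply/differentiable_continuous/derivable1_diffP; have [] := fd t.
rewrite /int01 /Rintegral (@continuous_FTC2 _ df f)//.
- exact: continuous_subspaceT.
- split; first by move=> t _; have [] := fd t.
  + exact/cvg_at_right_filter/cf.
  + exact/cvg_at_left_filter/cf.
- by move=> t _; rewrite derive1E; have [] := fd t.
Qed.

(** * Differentiation of ray averages *)

Lemma quadratic_differentiable (V W : normedModType R) (f : V -> W)
    (L : {linear V -> W}) (x : V) (C : R) : continuous L -> 0 <= C ->
  (forall u, `|u| <= 1 -> `|f (x + u) - f x - L u| <= C * `|u| ^+ 2) ->
  differentiable f x /\ 'd f x = L :> (V -> W).
Proof.
move=> cL C0 Cf.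
have fL : f \o shift x = cst (f x) + L +o_ 0 id.
  apply/eqaddoP => _/posnumP[e]; near=> u.
  have u1 : `|u| <= 1 by near: u; exact: nbhs0_le.
  (* The denominator is [C + 1] because [C] may be zero. *)
  have uC : `|u| <= e%:num / (C + 1).
    by near: u; apply: nbhs0_le; rewrite divr_gt0// ltr_wpDl.
  have := Cf u u1; rewrite [x + u]addrC => /le_trans Cfu.
  rewrite [X in `|X|](_ : _ = f (u + x) - f x - L u); last first.
    by rewrite !fctE opprD addrA.
  apply: Cfu; rewrite expr2 mulrA ler_wpM2r//.
  rewrite (le_trans (ler_wpM2l C0 uC))// mulrCA ler_piMr//.
  by rewrite ler_pdivrMr ?ltr_wpDl// mul1r lerDl.
have dE := diff_unique cL fL.
by split=> //; apply/diff_locallyP; rewrite dE.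
Unshelve. all: by end_near. Qed.

Lemma quadratic_partial n (f : 'rV[R]_n -> R) (a : 'I_n -> R)
    (x : 'rV[R]_n) (C : R) : 0 <= C ->
  (forall u : 'rV[R]_n, `|u| <= 1 ->
    `|f (x + u) - f x - \sum_i u 0 i * a i| <= C * `|u| ^+ 2) ->
  differentiable f x /\ forall i, 'D_(delta_mx 0 i) f x = a i.
Proof.
move=> C0 Cf; pose L (u : 'rV[R]_n) := \sum_i u 0 i * a i.
have lL : linear L.
  move=> c u v; rewrite /L scaler_sumr -big_split /=; apply: eq_bigr => i _.
  by rewrite !mxE mulrDl -mulrA.
pose Ll : {linear 'rV[R]_n -> R} := HB.pack L (GRing.isLinear.Build _ _ _ _ _ lL).
have cL : continuous Ll.
  apply: bounded_linear_continuous; apply/bounded_funP => r.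
  exists (\sum_i `|r| * `|a i|) => u ur.
  rewrite (le_trans (ler_norm_sum _ _ _))// ler_sum// => i _.
  rewrite normrM ler_wpM2r// (le_trans (coord_le_norm u i))//.
  by rewrite (le_trans ur)// ler_norm.
have [df dE] := quadratic_differentiable (L := Ll) cL C0 Cf.
split=> // i; rewrite deriveE// dE /= /L (bigD1 i)//= mxE !eqxx mul1r big1 ?addr0//.
by move=> j ji; rewrite mxE (negbTE ji) andbF mul0r.
Qed.

(* The weights t^k make the family closed under differentiation:
   d_i (avg k g) = avg k.+1 (d_i g). *)
Definition avg n k (g : 'rV[R]_n -> R) (w : 'rV[R]_n) : R :=
  int01 (fun t => t ^+ k * g (t *: w)).

Lemma continuous_ray n k (g : sfun R n) w :
  continuous (fun t : R => t ^+ k * g (t *: w)).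
Proof.
move=> t; apply: cvgM; first exact: exprn_continuous.
have [dg _] := is_derive_ray g w t.
by move/derivable1_diffP/differentiable_continuous in dg; exact: dg.
Qed.

(** The Taylor estimate at [t *: x] with increment [t *: u] is integrated over [t]. For [t] in
    [0, 1] and [u] of norm at most 1 all points stay in the ball of radius [|x| + 1], so [C] is
    independent of [t]. *)
Lemma avg_quadratic n k (g : sfun R n) (x : 'rV[R]_n) :
  exists2 C, 0 <= C & forall u : 'rV[R]_n, `|u| <= 1 ->
    `|avg k g (x + u) - avg k g x - \sum_i u 0 i * avg k.+1 (spartial i g) x|
      <= C * `|u| ^+ 2.
Proof.
have [C C0 HC] := sfun_taylor g (`|x| + 1); exists C => // u u1.
rewrite /avg -int01B; try exact: continuous_ray.
have -> : \sum_i u 0 i * int01 (fun t : R => t ^+ k.+1 * spartial i g (t *: x)) =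
    \sum_i int01 (fun t : R => u 0 i * (t ^+ k.+1 * spartial i g (t *: x))).
  by apply: eq_bigr => i _; rewrite -int01Z//; exact: continuous_ray.
have cr i : continuous (fun t : R => u 0 i * (t ^+ k.+1 * spartial i g (t *: x))).
  by move=> t; apply: cvgM; [exact: cvg_cst|exact: continuous_ray].
rewrite -int01_sum// -int01B; first last.
- exact: continuous_sumR.
- by move=> t; apply: cvgB; exact: continuous_ray.
apply: int01_le.
  move=> t; apply: cvgB; last exact: continuous_sumR.
  by apply: cvgB; exact: continuous_ray.
move=> t /andP[t0 t1].
have tx : `|t *: x| <= `|x| + 1.
  by rewrite normrZ ger0_norm// (le_trans (ler_piMl _ t1))// lerDl.
have tu : `|t *: u| <= `|u| by rewrite normrZ ger0_norm// ler_piMl.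
have txu : `|t *: x + t *: u| <= `|x| + 1.
  rewrite (le_trans (ler_normD _ _))// lerD// ?(le_trans tu)//.
  by rewrite normrZ ger0_norm// ler_piMl.
(* The coordinates of the increment [t *: u] contribute the extra factor that raises the weight to
   [k.+1]. *)
have -> : t ^+ k * g (t *: (x + u)) - t ^+ k * g (t *: x) -
    \sum_i u 0 i * (t ^+ k.+1 * spartial i g (t *: x)) =
  t ^+ k * (g (t *: x + t *: u) - g (t *: x) -
    \sum_i (t *: u) 0 i * spartial i g (t *: x)).
  rewrite !mulrBr scalerDr mulr_sumr; congr (_ - _); apply: eq_bigr => i _.
  by rewrite mxE exprSr; ring.
rewrite normrM (ger0_norm (exprn_ge0 _ t0)).
rewrite (le_trans (ler_piMl _ (exprn_ile1 _ t0 t1)))// (le_trans (HC _ _ tx txu))//.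
by rewrite ler_wpM2l// lerXn2r ?nnegrE.
Qed.

Lemma avg_partial n k (g : sfun R n) (x : 'rV[R]_n) : differentiable (avg k g) x /\
  forall i, 'D_(delta_mx 0 i) (avg k g) x = avg k.+1 (spartial i g) x.
Proof.
by have [C C0 HC] := avg_quadratic k g x; exact: quadratic_partial HC.
Qed.

(** Each partial derivative raises the weight and replaces [g] by a partial of [g], so the induction
    on the order keeps both [k] and [g] general. *)
Lemma avg_smooth n k (g : sfun R n) : smooth (avg k g).
Proof.
move=> m; elim: m k g => [//|m IH] k g; split=> [x|i].
  by have [] := avg_partial k g x.
rewrite (_ : (fun x => _) = avg k.+1 (spartial i g)); first exact: IH.
by apply/funext => x; have [_] := avg_partial k g x.
Qed.

Definition savg n (g : sfun R n) : sfun R n := SFun (avg_smooth 0 g).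

(** * The Euler field on C^oo(R^n) *)

Lemma euler_savg n (g : sfun R n) w :
  savg g w + \sum_i w 0 i * spartial i (savg g) w = g w.
Proof.
have -> : \sum_i w 0 i * spartial i (savg g) w =
    \sum_i int01 (fun t : R => w 0 i * (t ^+ 1 * spartial i g (t *: w))).
  apply: eq_bigr => i _; rewrite int01Z; last exact: continuous_ray.
  by congr (_ * _); have [_] := avg_partial 0 g w; exact.
rewrite [savg g w]/(avg 0 g w) /avg.
have cr i : continuous (fun t : R => w 0 i * (t ^+ 1 * spartial i g (t *: w))).
  by move=> t; apply: cvgM; [exact: cvg_cst|exact: continuous_ray].
rewrite -int01_sum// -int01D//; [|exact: continuous_ray|exact: continuous_sumR].
(* The integrand of the left-hand side is the derivative of [t * g (t *: w)], whose boundary values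
   are [g w] and 0. *)
have dF (t : R) : is_derive t 1 (fun t : R => t * g (t *: w))
    (t ^+ 0 * g (t *: w) + \sum_i w 0 i * (t ^+ 1 * spartial i g (t *: w))).
  have dg := is_derive_ray g w t; apply: is_derive_eq.
  rewrite /GRing.scale /= mulr1 expr0 mul1r expr1 addrC mulr_sumr; congr (_ + _).
  by apply: eq_bigr => i _; rewrite mulrCA.
rewrite (int01_FTC dF); first by rewrite scale1r mul1r mul0r subr0.
by move=> t; apply: cvgD; [exact: continuous_ray|exact: continuous_sumR].
Qed.

(** The mean value theorem gives an interior point [t] of the ray. Since [t] is nonzero, the
    derivative there may be multiplied by [t], which makes it the Euler derivative at [t *: w]. *)
Lemma euler0_cst n (g : sfun R n) w :
  (forall x : 'rV[R]_n, \sum_i x 0 i * spartial i g x = 0) -> g w = g 0.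
Proof.
move=> g0; have cg : {within `[0, 1], continuous (fun s : R => g (s *: w))}.
  by apply: derivable_within_continuous => t _; have [] := is_derive_ray g w t.
have [t] := MVT ltr01 (fun t _ => is_derive_ray g w t) cg.
rewrite in_itv/= => /andP[t0 _]; rewrite scale1r scale0r subr0 mulr1 => gw.
apply/eqP; rewrite -subr_eq0 gw -(mulIr_eq0 _ (mulIf (lt0r_neq0 t0))) mulrC mulr_sumr.
rewrite -[X in _ == X](g0 (t *: w)); apply/eqP/eq_bigr => i _.
by rewrite mxE mulrA.
Qed.

(** At the origin the Euler term vanishes, so the equation gives [f 0 = 0]; the Euler derivative is
    then zero everywhere. *)
Lemma euler_inj n (f : sfun R n) :
  (forall x : 'rV[R]_n, \sum_i x 0 i * spartial i f x + f 0 = 0) ->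
  forall x, f x = 0.
Proof.
move=> f0; have f00 : f 0 = 0.
  by rewrite -[RHS](f0 0) big1 ?add0r// => i _; rewrite mxE mul0r.
by move=> x; rewrite (euler0_cst x) ?f00// => y; rewrite -[RHS](f0 y) f00 addr0.
Qed.

(** On R^n this is the image under [dcirc] of the sum of the tensors of [f i] with e_i. *)
Definition sdot n (f : 'I_n -> sfun R n) : sfun R n :=
  ssum (fun i => smul (f i) (sproj R i)).

(** Writing E for the Euler field, E (x_j h) = x_j (h + E h) by the Leibniz rule, and [euler_savg]
    evaluates h + E h when h is an average. *)
Lemma euler_sdot_savg n (f : 'I_n -> sfun R n) (w : 'rV[R]_n) :
  \sum_i w 0 i * spartial i (sdot (fun j => savg (f j))) w = sdot f w.
Proof.
have dS i : spartial i (sdot (fun j => savg (f j))) w =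
    \sum_j ((i == j)%:R * savg (f j) w + w 0 j * spartial i (savg (f j)) w).
  rewrite /= (_ : (fun x => _) = \sum_j (smul (savg (f j)) (sproj R j) : 'rV[R]_n -> R)).
    rewrite derive_sum => [|j]; last exact/diff_derivable/sfun_differentiable.
    apply: eq_bigr => j _.
    have := congr1 (fun h : sfun R n => h w) (spartialM (savg (f j)) (sproj R j) i).
    by rewrite spartial_proj /= eq_sym mulrC => ->.
  by apply/funext => x; rewrite fct_sumE.
under eq_bigr do rewrite dS mulr_sumr.
rewrite exchange_big /=; apply: eq_bigr => j _.
rewrite -(euler_savg (f j) w) mulrC mulrDr.
under eq_bigr do rewrite mulrDr; rewrite big_split /=; congr (_ + _).
  rewrite (bigD1 j)//= eqxx mul1r big1 ?addr0// => i ij.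
  by rewrite (negbTE ij) mul0r mulr0.
by rewrite mulr_sumr; apply: eq_bigr => i _; rewrite mulrCA.
Qed.

(** Both sides have the same Euler derivative, so their difference is constant along rays; it is
    evaluated at the origin. *)
Lemma hadamard n (g : sfun R n) w :
  sdot (fun i => savg (spartial i g)) w = g w - g 0.
Proof.
pose h := sadd (sdot (fun i => savg (spartial i g))) (smul (scst n (-1)) g).
have hE x : h x = sdot (fun i => savg (spartial i g)) x - g x.
  by rewrite /= mulN1r.
have : h w = h 0.
  apply: euler0_cst => x.
  have dh i : x 0 i * spartial i h x =
      x 0 i * spartial i (sdot (fun i => savg (spartial i g))) x -
      x 0 i * spartial i g x.
    by rewrite /h spartialD spartialM spartial_cst /= mulr0 addr0 mulN1r mulrBr.
  under eq_bigr do rewrite dh.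
  rewrite sumrB euler_sdot_savg; apply/eqP; rewrite subr_eq0; apply/eqP.
  by apply: eq_bigr => i _; rewrite mulrC.
rewrite !hE => /eqP; rewrite subr_eq => /eqP ->.
rewrite [sdot _ 0]big1 => [|i _]; last by rewrite /= mxE mulr0.
by rewrite sub0r addrC.
Qed.

Lemma euler_surj n (g : sfun R n) : exists f : sfun R n,
  forall w : 'rV[R]_n, \sum_i w 0 i * spartial i f w + f 0 = g w.
Proof.
(* The Euler field removes the outer average; the inner one is the one in Hadamard's formula. *)
pose h := sdot (fun i => savg (savg (spartial i g))).
exists (sadd h (scst n (g 0))) => w.
under eq_bigr do rewrite spartialD spartial_cst /sadd /scst [X in _ * X]addr0.
rewrite (euler_sdot_savg (fun i => savg (spartial i g))) hadamard.
rewrite [sadd _ _ 0]/(h 0 + g 0) [h 0]big1 => [|i _]; last by rewrite /= mxE mulr0.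
by apply: etrans (subrK (g 0) _); congr (_ + _); exact: add0r.
Qed.

End RayAverage.

(** * Complements and generalized inverses in arbitrary dimension *)

Section LinearAlgebra.
Variable K : fieldType.

Definition lin_closed (V : lmodType K) (U : set V) :=
  forall c u v, U u -> U v -> U (c *: u + v).

(** Zorn's lemma yields a maximal [U] meeting [S] trivially; a vector outside [U + S] could be
    adjoined to [U], against maximality. *)
Lemma complement (V : lmodType K) (S : set V) : lin_closed S -> S 0 ->
  exists U : set V, [/\ lin_closed U, forall x, U x -> S x -> x = 0 &
    forall v, exists u s, [/\ U u, S s & v = u + s]].
Proof.
move=> lS S0.
(* P omits [U 0] so that it holds of the union of the empty chain. *)
pose P (U : set V) := lin_closed U /\ forall x, U x -> S x -> x = 0.
have [F FP totF|U [[lU US] maxU]] := @Zorn_bigcup V P.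
  split=> [c u v [A FA Au] [B FB Bv]|x [A FA Ax]]; last by have [_] := FP A FA; apply.
  have [AB|BA] := totF A B FA FB.
    by exists B => //; apply: (FP B FB).1 => //; exact: AB.
  by exists A => //; apply: (FP A FA).1 => //; exact: BA.
have U0 : U 0.
  (* A linearly closed set without 0 is empty, hence strictly inside the zero subspace. *)
  apply: contrapT => nU0; apply: (maxU [set 0]).
    split=> [x Ux|/(_ 0 erefl)//]; case: nU0.
    by have := lU (-1) _ _ Ux Ux; rewrite scaleN1r addNr.
  by split=> [c u v /= -> ->|x ->//]; rewrite scaler0 addr0.
exists U; split=> // v; apply: contrapT => nv.
pose B := [set x | exists c u, U u /\ x = c *: v + u].
apply: (maxU B).
  split=> [u Uu|/(_ v) BU]; first by exists 0, u; rewrite scale0r add0r.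
  apply: nv; exists v, 0; rewrite addr0; split=> //; apply: BU.
  by exists 1, 0; rewrite scale1r addr0.
split=> [c _ _ [a [u [Uu ->]]] [b [w [Uw ->]]]|_ [c [u [Uu ->]]] Sx].
  exists (c * a + b), (c *: u + w); split; first exact: lU.
  by rewrite scalerDr scalerDl scalerA addrACA.
have [c0|c0] := eqVneq c 0.
  by move: Sx; rewrite c0 scale0r add0r; exact: US.
(* If [c *: v + u] lies in [S] with [c] nonzero, solving for [v] gives the decomposition assumed not
   to exist. *)
case: nv; exists (- c^-1 *: u), (c^-1 *: (c *: v + u)); split.
- by have := lU (- c^-1) _ _ Uu U0; rewrite addr0.
- by have := lS c^-1 _ _ Sx S0; rewrite addr0.
- by rewrite scalerDr scalerA mulVf// scale1r scaleNr addrCA addNr addr0.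
Qed.

(** With [U] a complement of the image and [C] one of the kernel, [r] projects along [U] onto the
    image and then inverts [h] on [C]. *)
Lemma linear_ginverse (W V : lmodType K) (h : {linear W -> V}) :
  exists r : {linear V -> W}, forall w, h (r (h w)) = h w.
Proof.
have [||U [lU U0 dU]] := @complement V [set h w | w in setT].
- by move=> c _ _ [a _ <-] [b _ <-]; exists (c *: a + b); rewrite ?linearP.
- by exists 0; rewrite ?linear0.
have [||C [lC C0 dC]] := @complement W [set w | h w = 0].
- by move=> c a b /= ha hb; rewrite linearP ha hb scaler0 addr0.
- by rewrite /= linear0.
have /choice[r rP] (v : V) : exists w, C w /\ U (v - h w).
  have [u [_ [Uu [w _ <-] ->]]] := dU v.
  have [c [k [Cc /= hk ->]]] := dC w.
  by exists c; split=> //; rewrite linearD hk addr0 addrK.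
(* Uniqueness of the chosen preimage in [C] is what makes the choice function [r] linear. *)
have uniq v w w' : C w -> C w' -> U (v - h w) -> U (v - h w') -> w = w'.
  move=> Cw Cw' Uw Uw'; apply/eqP; rewrite -subr_eq0; apply/eqP; apply: C0.
    by have := lC (-1) _ _ Cw' Cw; rewrite scaleN1r addrC.
  rewrite /=; apply: U0; last by exists (w - w').
  have := lU (-1) _ _ Uw Uw'; rewrite scaleN1r opprB addrA subrK.
  by rewrite linearB.
have lr : linear r.
  move=> c u v; apply: (uniq (c *: u + v)); try by have [] := rP (c *: u + v).
    by apply: lC; [have [] := rP u|have [] := rP v].
  rewrite linearP opprD addrACA -scalerBr.
  by apply: lU; [have [] := rP u|have [] := rP v].
exists (HB.pack r (GRing.isLinear.Build _ _ _ _ _ lr) : {linear V -> W}) => w /=.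
apply/esym/eqP; rewrite -subr_eq0; apply/eqP; apply: U0; first by have [] := rP (h w).
by exists (w - r (h w)); rewrite ?linearB.
Qed.

End LinearAlgebra.

(** * Naturality and bijectivity of K *)

Section KIso.
Variable R : realType.
Implicit Types V W : lmodType R.

Lemma Smap_ginverse V W (h : {linear W -> V}) (r : {linear V -> W}) :
  (forall w, h (r (h w)) = h w) ->
  forall x, Smap h (Smap r (Smap h x)) = Smap h x.
Proof.
move=> hrh; elim/Sinf_ind_cterm => [w|n f a IH]; first by rewrite !Smap_eta hrh.
by rewrite !Smap_hom; congr cr_op; apply/funext => i /=.
Qed.

Lemma Smap0_natural V W (h : {linear V -> W}) x :
  Smap h (Smap (\0 : {linear V -> V}) x) = Smap (\0 : {linear W -> W}) (Smap h x).
Proof.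
elim/Sinf_ind_cterm: x => [v|n f a IH]; first by rewrite !Smap_eta /= linear0.
by rewrite !Smap_hom; congr cr_op; apply/funext => i /=.
Qed.

Lemma dcirc_natural V W (h : {linear V -> W}) z :
  Smap h (dcirc z) = dcirc (tmap (Smap h) h z).
Proof.
elim/tensor_ind: z => [|x y IHx IHy|a v]; first by rewrite !linear0.
  by rewrite !linearD /= IHx IHy.
by rewrite tmapE !dcircE (cinf_homM (Smap_hom h)) Smap_eta.
Qed.

Lemma Ktransf_natural V W (h : {linear V -> W}) x :
  Smap h (Ktransf x) = Ktransf (Smap h x).
Proof.
by rewrite /Ktransf linearD /= dcirc_natural (dtransfP R).1 Smap0_natural.
Qed.

Lemma Ktransf_linear V : linear (@Ktransf R V).
Proof. by move=> c x y; rewrite /Ktransf !linearP /= scalerDr addrACA. Qed.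

HB.instance Definition _ V := GRing.isLinear.Build R (Sinf V) (Sinf V) *:%R
  (@Ktransf R V) (@Ktransf_linear V).

Lemma Ktransf_row_inj n (f : sfun R n) : Ktransf (of_sfun f) = 0 -> of_sfun f = 0.
Proof.
have of_sfun0 : of_sfun (scst n 0) = 0 :> Sinf 'rV[R]_n by exact: cr_op0.
rewrite Ktransf_of_sfun -of_sfun0 => /(bij_inj (@of_sfun_bij R n)) Kf.
congr of_sfun.
apply: sfunP; apply: euler_inj => x.
rewrite -[RHS](congr1 (fun g : sfun R n => g x) Kf) /=; congr (_ + _).
by apply: eq_bigr => i _; rewrite mulrC.
Qed.

(** Write x = [Smap h] y with y over R^n. As [Smap h] need not be injective, [Ktransf x = 0] is
    pushed to R^n along [Smap r] instead: there [Smap r] x vanishes, and [Smap h] recovers x from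
    it. *)
Lemma Ktransf_inj V : injective (@Ktransf R V).
Proof.
apply: raddf_inj => x; have [n [h [f ->]]] := Sinf_of_sfun x => Kx0.
have [r hrh] := linear_ginverse h; rewrite -(Smap_ginverse hrh).
have [g' gg' g'g] := of_sfun_bij R n.
rewrite -(g'g (Smap r _)) Ktransf_row_inj ?linear0// g'g -Ktransf_natural Kx0.
exact: linear0.
Qed.

Lemma Ktransf_surj V (y : Sinf V) : exists x, Ktransf x = y.
Proof.
have [n [h [g ->]]] := Sinf_of_sfun y; have [f fg] := euler_surj g.
exists (Smap h (of_sfun f)); rewrite -Ktransf_natural; congr (Smap h _).
rewrite Ktransf_of_sfun; congr of_sfun; apply: sfunP => x.
by rewrite -fg /=; congr (_ + _); apply: eq_bigr => i _; rewrite mulrC.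
Qed.

Lemma KinvK V (y : Sinf V) : Ktransf (Kinv y) = y.
Proof.
rewrite /Kinv pinvK// inE; have [x <-] := Ktransf_surj y.
by exists x.
Qed.

(** * The Euler derivation on S^oo(V) *)

Definition euler V (x : Sinf V) : Sinf V := dcirc (dtransf V x).

Lemma dcirc_tact V (a : Sinf V) z : dcirc (tact a z) = a * dcirc z.
Proof.
elim/tensor_ind: z => [|x y IHx IHy|b v]; first by rewrite !linear0 mulr0.
  by rewrite !linearD /= IHx IHy mulrDr.
by rewrite tactE !dcircE mulrA.
Qed.

(** By uniqueness [dtransf] is the map [dcomp] read off from dual numbers, so it obeys the chain
    rule for every smooth operation. *)
Lemma euler_op V n (f : sfun R n) (a : 'I_n -> Sinf V) :
  euler (cr_op f a) = \sum_i cr_op (spartial i f) a * euler (a i).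
Proof.
have dE x : dtransf V x = dcomp x := is_dtransf_uniq (dtransfP R) (dcomp_is_dtransf R) x.
rewrite /euler dE dcomp_op linear_sum; apply: eq_bigr => i _.
by rewrite /= dcirc_tact dE.
Qed.

(** The product is itself a smooth operation, so the Leibniz rule is an instance of the chain
    rule. *)
Lemma eulerM V (x y : Sinf V) : euler (x * y) = x * euler y + y * euler x.
Proof.
rewrite -[x * y]/(cr_mul x y) /cr_mul euler_op !big_ord_recl big_ord0 addr0.
rewrite !spartialM !spartial_proj -!cr_opD -!cr_opM !cr_op_cst !cr_proj /pair2 /=.
by rewrite !scale1r !scale0r !mulr1 !mulr0 addr0 add0r addrC.
Qed.

Lemma Smap0_dcirc V (z : tensor (Sinf V) V) : Smap (\0 : {linear V -> V}) (dcirc z) = 0.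
Proof.
elim/tensor_ind: z => [|x y IHx IHy|a v]; first by rewrite !linear0.
  by rewrite !linearD /= IHx IHy addr0.
by rewrite dcircE (cinf_homM (Smap_hom _)) Smap_eta /= linear0 mulr0.
Qed.

(** * The operator P_v and the Rota-Baxter identity *)

Lemma Pop_K V (v : V) x : Ktransf (Pop v x) = x * eta v.
Proof. by rewrite /Pop /stransf KinvK tmapE dcircE /= /line scale1r. Qed.

(** Apply S^oo(0), evaluation at the origin, to [Pop_K]: it is idempotent and kills both the Euler
    part of K and [eta v]. *)
Lemma Smap0_Pop V (v : V) x : Smap (\0 : {linear V -> V}) (Pop v x) = 0.
Proof.
have S0S y : Smap (\0 : {linear V -> V}) (Smap (\0 : {linear V -> V}) y) =
    Smap (\0 : {linear V -> V}) y.
  elim/Sinf_ind_cterm: y => [w|n f a IH]; first by rewrite !Smap_eta.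
  by rewrite !Smap_hom; congr cr_op; apply/funext => i /=.
have := congr1 (Smap (\0 : {linear V -> V})) (Pop_K v x).
rewrite /Ktransf linearD /= Smap0_dcirc add0r S0S => ->.
by rewrite (cinf_homM (Smap_hom _)) Smap_eta /= linear0 mulr0.
Qed.

Lemma euler_Pop V (v : V) x : euler (Pop v x) = x * eta v.
Proof. by rewrite -Pop_K /Ktransf Smap0_Pop addr0. Qed.

End KIso.

Theorem proposition6p10 (R : realType) (V : lmodType R) (v : V) :
  @rota_baxter R (Sinf V) (Pop v).
Proof.
(* Both claims are tested after K, where [Pop_K] eliminates the outer operator. *)
split=> [c a b|a b]; apply: Ktransf_inj.
  by rewrite linearP /= !Pop_K mulrDl scalerAl.
(* S^oo(0) is multiplicative and vanishes on each factor, so K of the product reduces to its Euler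
   derivative. *)
rewrite linearD /= !Pop_K /Ktransf (cinf_homM (Smap_hom _)) !Smap0_Pop mul0r.
by rewrite addr0 -/(euler _) eulerM !euler_Pop addrC !mulrA [Pop v b * a]mulrC.
Qed.
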